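(* In any coordination game, for the perturbed learning automata dynamics, as $\epsilon\downarrow0$ and $\lambda\downarrow0$ the set $\mathcal{S}^*$ of stochastically stable pure strategy states satisfies $\mathcal{S}^*\subseteq\mathcal{S}_{\rm NE}$, where $\mathcal{S}_{\rm NE}$ is the set of pure strategy states corresponding to pure Nash equilibria.
   Context: Finite game: players $\mathcal{I}=\{1,\dots,n\}$, finite action sets $\mathcal{A}_i$, $\mathcal{A}=\prod_i\mathcal{A}_i$, utilities $u_i:\mathcal{A}\to\mathbb{R}$. ${\rm BR}_i(\alpha)=\arg\max_{a\in\mathcal{A}_i}u_i(a,\alpha_{-i})$; a pure Nash equilibrium is $\alpha^*$ with $\alpha^*_i\in{\rm BR}_i(\alpha^* )$ for all $i$. Coordination game: $u_i(\alpha)>0$ for all $i,\alpha$, and for every $\alpha$, player $i$ and $\alpha'_i\in{\rm BR}_i(\alpha)$, $u_j(\alpha'_i,\alpha_{-i})\ge u_j(\alpha_i,\alpha_{-i})$ for all $j$. Perturbed learning automata (step size $\epsilon>0$ with $0<\epsilon u_i(\alpha)<1$, perturbation $\lambda>0$): state $(\alpha,x)$ with $x_i\in\Delta(|\mathcal{A}_i|)$ (actions identified with unit vectors $e_{\alpha_i}$); each agent $i$ independently picks $\alpha_i(t+1)$ according to $x_i(t)$ w.p. $1-\lambda$ and uniformly on $\mathcal{A}_i$ w.p. $\lambda$, then $x_i(t+1)=x_i(t)+\epsilon u_i(\alpha(t+1))(e_{\alpha_i(t+1)}-x_i(t))$. Pure strategy states: $(\alpha,x)$ with $x_i=e_{\alpha_i}$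 for all $i$ (set $\mathcal{S}$). Any invariant probability measures $\mu_\lambda$ of this chain converge weakly as $\lambda\to0$ to $\sum_{s\in\mathcal{S}}\pi_s\delta_s$ for a probability vector $\pi=\pi(\epsilon)$; a pure strategy state $s$ is stochastically stable (as $\epsilon\downarrow0,\lambda\downarrow0$) if $\pi_s(\epsilon)$ does not vanish as $\epsilon\downarrow0$. *)

(* Defs.v *)
From HB Require Import structures.
From mathcomp Require Import all_boot all_order all_algebra.
From mathcomp Require Import all_classical all_reals all_analysis.
Set Implicit Arguments. Unset Strict Implicit. Unset Printing Implicit Defensive.
Import Order.TTheory GRing.Theory Num.Theory.
Local Open Scope classical_set_scope.
Local Open Scope ring_scope.

Section LearningAutomata.
Variables (R : realType) (I : finType) (A : I -> finType).

Definition profile := {dffun forall i : I, A i}.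

(** coordinates of a mixed-strategy vector x = (x_i)_i, x_i in R^{|A_i|} *)
Definition coord := {i : I & A i}.

Definition dev (al : profile) (i : I) (a : A i) : profile :=
  @finfun I (fun j => A j) (@dfwith I (fun j => A j) (fun j => al j) i a).
Arguments dev al i a : clear implicits.

Variable u : I -> profile -> R.

Definition best_reply (i : I) (al : profile) (a : A i) : Prop :=
  forall b : A i, u i (dev al i b) <= u i (dev al i a).
Arguments best_reply i al a : clear implicits.

Definition pure_NE (al : profile) : Prop :=
  forall i : I, best_reply i al (al i).

Definition coordination_game : Prop :=
  (forall i al, 0 < u i al) /\
  (forall al i (a : A i), best_reply i al a ->
     forall j, u j al <= u j (dev al i a)).

Definition ambient := (profile * (coord -> R))%type.

Definition in_states (s : ambient) : Prop :=
  forall i : I, (forall a : A i, 0 <= s.2 (Tagged A a)) /\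
                \sum_(a : A i) s.2 (Tagged A a) = 1.

Definition pure_state (al : profile) : ambient :=
  (al, fun k : coord => ((tagged k == al (tag k)) : nat)%:R).

Definition next_prob (lam : R) (x : coord -> R) (al' : profile) : R :=
  \prod_(i : I) ((1 - lam) * x (Tagged A (al' i)) + lam / (#|A i|)%:R).

Definition next_strat (eps : R) (x : coord -> R) (al' : profile) : coord -> R :=
  fun k => x k + eps * u (tag k) al' *
             (((tagged k == al' (tag k)) : nat)%:R - x k).

Definition kernel (eps lam : R) (s : ambient) (B : set ambient) : R :=
  \sum_(al' : profile) next_prob lam s.2 al' * \1_B (al', next_strat eps s.2 al').

(** Borel sigma-algebra on the ambient space A x R^coord
    (product of the discrete sigma-algebra and Borel sets on each coordinate) *)
Definition ambient_gen : set (set ambient) :=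
  [set B | (exists al : profile, B = [set s | s.1 = al]) \/
           (exists (k : coord) (E : set R), measurable E /\ B = [set s | E (s.2 k)])].

(** continuity on A x R^coord (A discrete, R^coord with its usual topology) *)
Definition cont_ambient (f : ambient -> R) : Prop :=
  forall (al : profile) (x : coord -> R) (e : R), 0 < e ->
    exists2 d : R, 0 < d &
      forall y : coord -> R, (forall k, `|x k - y k| < d) ->
        `|f (al, x) - f (al, y)| < e.

Definition valid_eps (eps : R) : Prop :=
  forall i al, 0 < eps * u i al < 1.

End LearningAutomata.

(** Measurable structure: needs a point, hence a default profile a0. *)
Section Measurable.
Variables (R : realType) (I : finType) (A : I -> finType) (a0 : forall i, A i).

Definition state_space := ambient R A.
HB.instance Definition _ := Choice.on state_space.
HB.instance Definition _ := isPointed.Build state_space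
  ([ffun i => a0 i], fun _ => 0).

Definition stateT := g_sigma_algebraType (@ambient_gen R I A : set (set state_space)).

Variable u : I -> profile A -> R.

Definition invariant (eps lam : R) (mu : probability stateT R) : Prop :=
  mu (~` [set s : stateT | in_states s]) = 0%E /\
  forall B : set stateT, measurable B ->
    mu B = (\int[mu]_(s in [set: stateT]) (kernel u eps lam s B)%:E)%E.

Definition limit_vector (eps : R) (pi : profile A -> R) : Prop :=
  (forall al, 0 <= pi al) /\ \sum_(al : profile A) pi al = 1 /\
  forall mu : R -> probability stateT R,
    (forall lam, 0 < lam < 1 -> invariant eps lam (mu lam)) ->
    forall f : stateT -> R,
      measurable_fun [set: stateT] f ->
      (exists M : R, forall s, `|f s| <= M) ->
      cont_ambient f ->
      (fun lam => (\int[mu lam]_(s in [set: stateT]) (f s)%:E)%E)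
        @ 0^'+ --> (\sum_(al : profile A) pi al * f (@pure_state R I A al))%:E.

Definition stochastically_stable (al : profile A) : Prop :=
  exists Pi : R -> profile A -> R,
    (forall eps, valid_eps u eps -> limit_vector eps (Pi eps)) /\
    ~ ((fun eps => Pi eps al) @ 0^'+ --> 0).

End Measurable.

(* Main.v *)
Require Import Defs.
From HB Require Import structures.
From mathcomp Require Import all_boot all_order all_algebra.
From mathcomp Require Import all_classical all_reals all_analysis.
From mathcomp Require Import measurable_realfun ring lra.

Set Implicit Arguments. Unset Strict Implicit. Unset Printing Implicit Defensive.
Import Order.TTheory GRing.Theory Num.Theory.
Import numFieldNormedType.Exports.
Local Open Scope classical_set_scope.
Local Open Scope ring_scope.

(** If [mu] is invariant for [lam > 0] and [f >= 0] is a function of the mixed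
    strategies that is subharmonic for the unperturbed dynamics, then the
    one-tremble part [L f] of the perturbed kernel satisfies
    [(1 - lam)^(n-1) E[L f] <= n E[f]].  As [lam] goes to [0] this becomes
    [sum_al pi al * (L f (al) - n * f (al)) <= 0] over the pure states.  The
    function [f] is the maximum, over the profiles [al] and the players [i] who
    best reply in [al], of [B^rank al * w / (w + c eps) * prod_(j != i) x_j(al_j)^k],
    where [w] is the weight of the best replies of [i] against [al] and profiles are
    ranked by welfare.  In a coordination game a tremble of a dissatisfied player
    to a best reply raises the rank, and [w / (w + c eps)] is then of order [1]
    although [w] is of order [eps]: so [L f - n f >= 1] outside the Nash
    equilibria, while [L f - n f >= - C eps] at each of them.  Hence
    [pi al <= C eps] whenever [al] is not an equilibrium.

    The limit vector says nothing unless invariant measures exist for every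
    [lam].  Cesaro means along an ultrafilter give stationary probabilities for
    the finite words of joint actions; these are realised by nested subintervals
    of [[0, 1[], and since the updates are contractions the state is a function
    of the infinite past, whose law is invariant. *)

(** * Bounded measurable functions *)

Section BoundedMeasurable.
Context {d : measure_display} {T : measurableType d} {R : realType}.
Implicit Types f g h : T -> R.

Definition bounded_measurable f :=
  measurable_fun [set: T] f /\ exists M, forall s, `|f s| <= M.

Lemma bounded_measurable_cst (c : R) : bounded_measurable (fun=> c).
Proof. by split; [exact: measurable_cst | exists `|c|]. Qed.

Lemma bounded_measurableD f g : bounded_measurable f -> bounded_measurable g ->
  bounded_measurable (fun s => f s + g s).
Proof.
move=> [mf [M fM]] [mg [N gN]]; split; first exact: measurable_funD.
by exists (M + N) => s; rewrite (le_trans (ler_normD _ _))// lerD.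
Qed.

Lemma bounded_measurableM f g : bounded_measurable f -> bounded_measurable g ->
  bounded_measurable (fun s => f s * g s).
Proof.
move=> [mf [M fM]] [mg [N gN]]; split; first exact: measurable_funM.
by exists (M * N) => s; rewrite normrM ler_pM.
Qed.

Lemma bounded_measurable_sum (J : Type) (r : seq J) (P : pred J)
    (F : J -> T -> R) : (forall j, P j -> bounded_measurable (F j)) ->
  bounded_measurable (fun s => \sum_(j <- r | P j) F j s).
Proof.
move=> bF; elim: r => [|j r IH].
  under eq_fun do rewrite big_nil; exact: bounded_measurable_cst.
under eq_fun do rewrite big_cons.
by case Pj: (P j) => //; apply: bounded_measurableD => //; exact: bF.
Qed.

Lemma bounded_measurable_indic (B : set T) :
  measurable B -> bounded_measurable (\1_B : T -> R).
Proof.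
move=> mB; split; first exact: measurable_indic.
by exists 1 => s; rewrite indicE; case: (_ \in _); rewrite ?normr1 ?normr0.
Qed.

Lemma bounded_measurable_comp (T' : T -> T) f :
  measurable_fun [set: T] T' -> bounded_measurable f ->
  bounded_measurable (fun s => f (T' s)).
Proof.
move=> mT [mf [M fM]]; split; last by exists M.
exact: (measurableT_comp mf mT).
Qed.

Section Integral.
Variable mu : probability T R.

Lemma bounded_measurable_integrable f :
  bounded_measurable f -> mu.-integrable [set: T] (EFin \o f).
Proof.
move=> [mf [M fM]]; apply: measurable_bounded_integrable => //.
  by rewrite [X in (X < _)%E](@probability_setT _ _ _ mu) ltry.
by exists M; split; [exact: num_real | move=> x Mx s _; exact: le_trans (ltW Mx)].
Qed.

Lemma bounded_measurable_EFin f : bounded_measurable f ->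
  (\int[mu]_s (f s)%:E = (\int[mu]_s f s)%:E)%E.
Proof.
by move=> /bounded_measurable_integrable fi; rewrite fineK//; exact: integrable_fin_num.
Qed.

Lemma expect_cst (c : R) : \int[mu]_s c = c.
Proof. by rewrite Rintegral_cst// [X in fine X](@probability_setT _ _ _ mu) mulr1. Qed.

Lemma expectD f g : bounded_measurable f -> bounded_measurable g ->
  \int[mu]_s (f s + g s) = \int[mu]_s f s + \int[mu]_s g s.
Proof. by move=> bf bg; apply: RintegralD => //; exact: bounded_measurable_integrable. Qed.

Lemma expectB f g : bounded_measurable f -> bounded_measurable g ->
  \int[mu]_s (f s - g s) = \int[mu]_s f s - \int[mu]_s g s.
Proof. by move=> bf bg; apply: RintegralB => //; exact: bounded_measurable_integrable. Qed.

Lemma expectZ (c : R) f : bounded_measurable f ->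
  \int[mu]_s (c * f s) = c * \int[mu]_s f s.
Proof. by move=> bf; apply: RintegralZl => //; exact: bounded_measurable_integrable. Qed.

Lemma expect_sum (J : Type) (r : seq J) (P : pred J) (F : J -> T -> R) :
  (forall j, P j -> bounded_measurable (F j)) ->
  \int[mu]_s (\sum_(j <- r | P j) F j s) = \sum_(j <- r | P j) \int[mu]_s F j s.
Proof.
move=> bF; elim: r => [|j r IH].
  by under eq_Rintegral do rewrite big_nil; rewrite expect_cst big_nil.
under eq_Rintegral do rewrite big_cons.
rewrite big_cons; case Pj: (P j) => //.
by rewrite expectD ?IH//; [exact: bF | exact: bounded_measurable_sum].
Qed.

Lemma expect_le f g : bounded_measurable f -> bounded_measurable g ->
  (forall s, f s <= g s) -> \int[mu]_s f s <= \int[mu]_s g s.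
Proof.
move=> bf bg fg; apply: le_Rintegral => //; exact: bounded_measurable_integrable.
Qed.

Lemma expect_indic (B : set T) : measurable B -> \int[mu]_s \1_B s = fine (mu B).
Proof. by move=> mB; rewrite /Rintegral integral_indic// setIT. Qed.

Lemma expect_dist f g (e : R) : bounded_measurable f -> bounded_measurable g ->
  (forall s, `|f s - g s| <= e) -> `|\int[mu]_s f s - \int[mu]_s g s| <= e.
Proof.
move=> bf bg fg.
have shift f' g' : bounded_measurable f' -> bounded_measurable g' ->
    (forall s, f' s <= g' s + e) -> \int[mu]_s f' s <= \int[mu]_s g' s + e.
  move=> bf' bg' fg'; have be := bounded_measurable_cst e.
  rewrite -[X in _ <= _ + X]expect_cst -expectD//.
  by apply: expect_le => //; exact: bounded_measurableD.
rewrite ler_norml lerNl opprB !lerBlDl !shift// => s.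
  by have := fg s; rewrite ler_norml => /andP[]; lra.
by have := fg s; rewrite ler_norml => /andP[]; lra.
Qed.

Lemma bounded_convergence (F : (T -> R)^nat) f (M : R) :
  (forall n, measurable_fun [set: T] (F n)) -> bounded_measurable f ->
  (forall n s, `|F n s| <= M) -> (forall s, F n s @[n --> \oo] --> f s) ->
  \int[mu]_s F n s @[n --> \oo] --> \int[mu]_s f s.
Proof.
move=> mF bf FM Ff.
have [] := @dominated_convergence _ T R mu setT measurableT
  (fun n s => (F n s)%:E) (fun s => (f s)%:E) (fun=> M%:E).
- by move=> n; exact/measurable_EFinP.
- by apply/measurable_EFinP; case: bf.
- by apply: aeW => s _; apply: cvg_EFin; [exact: nearW | exact: Ff].
- by apply: (bounded_measurable_integrable (bounded_measurable_cst M)).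
- by apply: aeW => s n _; rewrite lee_fin.
move=> _ _ H; apply: fine_cvg; rewrite -bounded_measurable_EFin//.
Qed.

End Integral.
End BoundedMeasurable.

(** * Level sets, and stationarity carried from sets to functions *)

Section LayerCake.
Context {R : realType}.

(** The sum is the ceiling of [z]: it counts the naturals below [z], all of which are below [N]. *)
Lemma count_below_approx (N : nat) (z : R) : 0 <= z <= N%:R ->
  z <= \sum_(k < N) ((k%:R < z)%R : nat)%:R <= z + 1.
Proof.
elim: N => [|N IH] /andP[z0 zN]; first by rewrite big_ord0; lra.
rewrite big_ord_recr /=; have [zleN|Nz] := leP z N%:R.
  by rewrite addr0; apply: IH; rewrite z0.
rewrite (eq_bigr (fun=> 1)) => [|k _]; last first.
  by rewrite (lt_trans _ Nz)// ltr_nat.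
rewrite sumr_const card_ord -mulr_natr mul1r natr1 in zN *.
by rewrite zN /= -natr1; lra.
Qed.
End LayerCake.

Section Stationary.
Context {d : measure_display} {T : measurableType d} {R : realType}.
Variables (J : finType) (p : J -> T -> R) (th : J -> T -> T).
Hypotheses (bp : forall j, bounded_measurable (p j))
  (mth : forall j, measurable_fun [set: T] (th j)).

Definition transition (f : T -> R) (s : T) := \sum_j p j s * f (th j s).

Lemma bounded_measurable_transition f :
  bounded_measurable f -> bounded_measurable (transition f).
Proof.
move=> bf; apply: bounded_measurable_sum => j _; apply: bounded_measurableM => //.
exact: bounded_measurable_comp.
Qed.

Lemma transition_dist : exists2 C : R, 0 <= C & forall f g e s, 0 <= e ->
  (forall t, `|f t - g t| <= e) -> `|transition f s - transition g s| <= C * e.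
Proof.
have /choice[M pM] : forall j, exists M, forall s, `|p j s| <= M.
  by move=> j; have [_] := bp j.
exists (\sum_j `|M j|); first by rewrite sumr_ge0.
move=> f g e s e0 fg; rewrite /transition -sumrB mulr_suml.
rewrite (le_trans (ler_norm_sum _ _ _))//; apply: ler_sum => j _.
by rewrite -mulrBr normrM ler_pM// (le_trans (pM j s))// ler_norm.
Qed.

Lemma transition_sum (L : Type) (r : seq L) (c : R) (F : L -> T -> R) s :
  transition (fun s => \sum_(l <- r) c * F l s) s =
  \sum_(l <- r) c * transition (F l) s.
Proof.
rewrite /transition; under eq_bigr do rewrite mulr_sumr.
rewrite exchange_big /=; apply: eq_bigr => l _; rewrite mulr_sumr.
by apply: eq_bigr => j _; rewrite mulrCA.
Qed.

(** Layer-cake approximation: [f] is within [1 / N] of the average of the indicators of its level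
    sets [k < N f], for [k < N]. Both sides are continuous for the uniform norm, so the identity
    passes from indicators to [f]. *)
Lemma stationary_expect (mu : probability T R) :
  (forall B, measurable B -> \int[mu]_s \1_B s = \int[mu]_s transition \1_B s) ->
  forall f : T -> R, measurable_fun [set: T] f -> (forall s, 0 <= f s <= 1) ->
  \int[mu]_s f s = \int[mu]_s transition f s.
Proof.
move=> inv f mf f01.
have bf : bounded_measurable f.
  by split=> //; exists 1 => s; have /andP[f0 f1] := f01 s; rewrite ger0_norm.
have [C C0 dist] := transition_dist.
pose B (N k : nat) := [set s | k%:R < N%:R * f s].
have mB N k : measurable (B N k).
  have : measurable_fun [set: T] (fun s => k%:R < N%:R * f s).
    by apply: measurable_fun_ltr => //; exact: measurable_funM.
  by move=> /(_ measurableT [set true] I); rewrite setTI.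
pose g (N : nat) s : R := \sum_(k < N) N%:R^-1 * \1_(B N k) s.
have bB N k := bounded_measurable_indic (R := R) (mB N k).
have bcB N k : bounded_measurable (fun s => N%:R^-1 * \1_(B N k) s : R).
  by apply: bounded_measurableM => //; exact: bounded_measurable_cst.
have bg N : bounded_measurable (g N) by exact: bounded_measurable_sum.
have fg (N : nat) s : `|f s - g N.+1 s| <= N.+1%:R^-1.
  have N0 : 0 < N.+1%:R :> R by rewrite ltr0n.
  have /andP[f0 f1] := f01 s.
  have /(@count_below_approx R) : 0 <= N.+1%:R * f s <= N.+1%:R.
    by rewrite mulr_ge0 ?ler_piMr ?ler0n.
  set S := \sum_(k < _) _ => SS.
  have -> : g N.+1 s = N.+1%:R^-1 * S.
    rewrite /g /S mulr_sumr; apply: eq_bigr => k _; congr (_ * _).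
    by rewrite indicE; congr (nat_of_bool _)%:R; apply/idP/idP => [/set_mem|/mem_set].
  rewrite -[f s](mulKf (lt0r_neq0 N0)) -mulrBr normrM gtr0_norm ?invr_gt0//.
  rewrite ler_piMr ?invr_ge0 ?ler0n// ler_norml; lra.
have gE (N : nat) : \int[mu]_s g N s = \int[mu]_s transition (g N) s.
  rewrite expect_sum//.
  have -> : transition (g N) = fun s => \sum_(k < N) N%:R^-1 * transition \1_(B N k) s.
    by apply/funext => s; rewrite /g transition_sum.
  rewrite expect_sum => [|k _]; last first.
    apply: bounded_measurableM; first exact: bounded_measurable_cst.
    exact: bounded_measurable_transition.
  apply: eq_bigr => k _; rewrite !expectZ ?inv//.
  exact: bounded_measurable_transition.
apply/eqP; rewrite -subr_eq0 -normr_le0; apply/ler_addgt0Pl => e e0.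
rewrite addr0.
(* Replacing [f] by [g] costs [1 / (N + 1)] on the left and [C / (N + 1)] on the right; beyond [D]
   the total is at most [e]. *)
pose D := (1 + C) / e.
have D0 : 0 < D by rewrite divr_gt0// ltr_pwDl.
have [N DN] : exists N : nat, D < N.+1%:R.
  exists (Num.truncn D); exact: truncnS_gt.
have iN0 : 0 <= N.+1%:R^-1 :> R by rewrite invr_ge0 ler0n.
have := expect_dist mu bf (bg N.+1) (fg N).
have := expect_dist mu (bounded_measurable_transition (bg N.+1))
  (bounded_measurable_transition bf)
  (fun s => dist _ _ _ s iN0 (fun t => eq_ind _ (fun x => x <= _) (fg N t) _ (distrC _ _))).
rewrite -gE => h1 h2.
have h3 : (1 + C) * N.+1%:R^-1 <= e.
  by rewrite ler_pdivrMr ?ltr0n// mulrC -ler_pdivrMr// ltW.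
rewrite -[X in `|X|](subrKA (\int[mu]_s g N.+1 s)).
by rewrite (le_trans (ler_normD _ _))// (le_trans _ h3)// mulrDl mul1r lerD.
Qed.

End Stationary.

(** * Regular functions of the state *)

(* The type [stateT R A] does not mention the default profile that its measurable
   structure depends on, so the structure is named explicitly. *)
Definition learning_space (R : realType) (I : finType) (A : I -> finType)
    (a0 : forall i, A i) : measurableType (@ambient_gen R I A).-sigma :=
  @measurable_structure_g_sigma_algebraType__canonical__measurable_structure_Measurable
    (Defs_state_space__canonical__classical_sets_Pointed R a0) (@ambient_gen R I A).

Section Clamp.
Context {R : realType}.
Implicit Types y z : R.

(** The ambient space allows arbitrary real coordinates. Projecting them to [[0, 1]] keeps the
    functions below bounded and changes nothing on genuine states. *)
Definition clamp y : R := Num.min 1 (Num.max 0 y).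

Lemma clamp01 y : 0 <= clamp y <= 1.
Proof. by rewrite /clamp le_min ler01 le_max lexx /= ge_min lexx. Qed.

Lemma clamp_id y : 0 <= y <= 1 -> clamp y = y.
Proof. by move=> /andP[y0 y1]; rewrite /clamp (max_idPr y0) (min_idPr y1). Qed.

Lemma clamp_lipschitz y z : `|clamp y - clamp z| <= `|y - z|.
Proof.
wlog yz : y z / y <= z => [H|].
  by have [/H//|/ltW/H] := leP y z; rewrite distrC [X in _ <= X]distrC.
have clampE t : clamp t = if t <= 0 then 0 else if 1 <= t then 1 else t.
  rewrite /clamp; have [t0|t0] := leP t 0; first by rewrite (min_idPr ler01).
  by have [t1|t1] := leP 1 t.
rewrite distrC [X in _ <= X]distrC (ger0_norm (_ : 0 <= z - y)) ?subr_ge0//.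
rewrite !clampE ger0_norm.
  by case: (leP y 0); case: (leP z 0); case: (leP 1 y); case: (leP 1 z) => *; lra.
by case: (leP y 0); case: (leP z 0); case: (leP 1 y); case: (leP 1 z) => *; lra.
Qed.

End Clamp.

Section Regular.
Context {R : realType} {I : finType} {A : I -> finType} (a0 : forall i, A i).
Notation S := (learning_space R a0).
Implicit Types f g : S -> R.

(** Sup-norm neighbourhoods of [x]: with continuity phrased along this filter, closure under sums
    and products follows from the algebra of limits. *)
Definition near_profile (x : Defs.coord A -> R) : set_system (Defs.coord A -> R) :=
  filter_from [set d : R | 0 < d] (fun d => [set y | forall k, `|x k - y k| < d]).

#[local] Instance near_profile_filter x : Filter (near_profile x).
Proof.
apply: filter_from_filter; first by exists 1 => /=.
move=> d e /= d0 e0; exists (Num.min d e); first by rewrite /= lt_min d0.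
by move=> y /= yde; split=> k; have := yde k; rewrite lt_min => /andP[].
Qed.

Lemma cont_ambientE (f : ambient R A -> R) : cont_ambient f <->
  forall al x, f (al, y) @[y --> near_profile x] --> f (al, x).
Proof.
split=> [fc al x|fc al x e e0].
  apply/cvgrPdist_lt => e e0; have [d d0 dP] := fc al x e e0.
  by exists d => // y /= /dP.
by have /cvgrPdist_lt /(_ _ e0)[d d0 dP] := fc al x; exists d.
Qed.

Definition regular f := bounded_measurable f /\ cont_ambient f.

Lemma regular_cst c : regular (fun=> c).
Proof.
split; first exact: bounded_measurable_cst.
by apply/cont_ambientE => al x; exact: cvg_cst.
Qed.

Lemma regularD f g : regular f -> regular g -> regular (fun s => f s + g s).
Proof.
move=> [bf /cont_ambientE cf] [bg /cont_ambientE cg]; split.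
  exact: bounded_measurableD.
by apply/cont_ambientE => al x; apply: cvgD; [exact: cf | exact: cg].
Qed.

Lemma regularM f g : regular f -> regular g -> regular (fun s => f s * g s).
Proof.
move=> [bf /cont_ambientE cf] [bg /cont_ambientE cg]; split.
  exact: bounded_measurableM.
by apply/cont_ambientE => al x; apply: cvgM; [exact: cf | exact: cg].
Qed.

Lemma regularZ c f : regular f -> regular (fun s => c * f s).
Proof. by move=> rf; apply: regularM => //; exact: regular_cst. Qed.

Lemma regular_sum (J : Type) (r : seq J) (P : pred J) (F : J -> S -> R) :
  (forall j, P j -> regular (F j)) -> regular (fun s => \sum_(j <- r | P j) F j s).
Proof.
move=> rF; elim: r => [|j r IH].
  under eq_fun do rewrite big_nil; exact: regular_cst.
under eq_fun do rewrite big_cons.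
by case Pj: (P j) => //; apply: regularD => //; exact: rF.
Qed.

Lemma regular_prod (J : Type) (r : seq J) (P : pred J) (F : J -> S -> R) :
  (forall j, P j -> regular (F j)) -> regular (fun s => \prod_(j <- r | P j) F j s).
Proof.
move=> rF; elim: r => [|j r IH].
  under eq_fun do rewrite big_nil; exact: regular_cst.
under eq_fun do rewrite big_cons.
by case Pj: (P j) => //; apply: regularM => //; exact: rF.
Qed.

Lemma regular_exp f n : regular f -> regular (fun s => f s ^+ n).
Proof.
move=> rf; elim: n => [|n IH]; first exact: regular_cst.
by under eq_fun do rewrite exprS; exact: regularM.
Qed.

Lemma measurable_coord k : measurable_fun [set: S] (fun s : S => s.2 k).
Proof.
move=> _ B mB; rewrite setTI.
by apply: sub_sigma_algebra; right; exists k, B.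
Qed.

Lemma measurable_action al : measurable ([set s | s.1 = al] : set S).
Proof. by apply: sub_sigma_algebra; left; exists al. Qed.

Lemma lipschitz_measurable (h : R -> R) C : 
  (forall y z, `|h y - h z| <= C * `|y - z|) -> measurable_fun [set: R] h.
Proof.
move=> hC; apply: continuous_measurable_fun => y.
apply/cvgrPdist_lt => e e0.
have C0 : 0 < `|C| + 1 by rewrite ltr_wpDl.
near=> z.
rewrite (le_lt_trans (hC _ _))// (@le_lt_trans _ _ ((`|C| + 1) * `|y - z|))//.
  by rewrite ler_wpM2r// (le_trans (ler_norm C))// lerDl.
rewrite mulrC -ltr_pdivlMr//; near: z.
by apply: cvgr_dist_lt => //; rewrite divr_gt0.
Unshelve. all: by end_near. Qed.

Lemma regular_comp (h : R -> R) C f : 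
  (forall y z, `|h y - h z| <= C * `|y - z|) -> regular f ->
  regular (fun s => h (f s)).
Proof.
move=> hC [[mf [M fM]] fc]; split; first split.
- exact: (measurableT_comp (lipschitz_measurable hC) mf).
- exists (`|h 0| + `|C| * M) => s.
  rewrite -[h (f s)](subrK (h 0)) addrC (le_trans (ler_normD _ _))// lerD//.
  rewrite (le_trans (hC _ _))// subr0 (@le_trans _ _ (`|C| * `|f s|))//.
    by rewrite ler_wpM2r// ler_norm.
  by rewrite ler_wpM2l.
- move=> al x e e0.
  have C0 : 0 < `|C| + 1 by rewrite ltr_wpDl.
  have [|d d0 dP] := fc al x (e / (`|C| + 1)); first by rewrite divr_gt0.
  exists d => // y /dP; rewrite ltr_pdivlMr// mulrC; apply: le_lt_trans.
  by rewrite (le_trans (hC _ _))// ler_wpM2r// (le_trans (ler_norm C))// lerDl.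
Qed.

Lemma regular_max f g : regular f -> regular g -> regular (fun s => Num.max (f s) (g s)).
Proof.
move=> rf rg; under eq_fun do rewrite maxr_absE mulrC.
have rfg : regular (fun s => f s - g s).
  by under eq_fun do rewrite -mulN1r; apply: regularD => //; exact: regularZ.
apply: regularZ; apply: regularD; first exact: regularD.
by apply: (@regular_comp Num.norm 1) => // y z; rewrite mul1r ler_dist_dist.
Qed.

Lemma regular_bigmax (J : Type) (r : seq J) (P : pred J) (F : J -> S -> R) :
  (forall j, P j -> regular (F j)) ->
  regular (fun s => \big[Num.max/0]_(j <- r | P j) F j s).
Proof.
move=> rF; elim: r => [|j r IH].
  under eq_fun do rewrite big_nil; exact: regular_cst.
under eq_fun do rewrite big_cons.
by case Pj: (P j) => //; apply: regular_max => //; exact: rF.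
Qed.

Lemma regular_lipschitz_coord (h : R -> R) C M k :
  (forall y z, `|h y - h z| <= C * `|y - z|) -> (forall y, `|h y| <= M) ->
  regular (fun s : S => h (s.2 k)).
Proof.
move=> hC hM; split; first split.
- exact: (measurableT_comp (lipschitz_measurable hC) (measurable_coord k)).
- by exists M.
- move=> al x e e0.
  have C0 : 0 < `|C| + 1 by rewrite ltr_wpDl.
  exists (e / (`|C| + 1)); first by rewrite divr_gt0.
  move=> y /(_ k) /=; rewrite ltr_pdivlMr// mulrC; apply: le_lt_trans.
  by rewrite (le_trans (hC _ _))// ler_wpM2r// (le_trans (ler_norm C))// lerDl.
Qed.

Lemma regular_clamp k : regular (fun s : S => clamp (s.2 k)).
Proof.
apply: (@regular_lipschitz_coord _ 1 1).
  by move=> y z; rewrite mul1r clamp_lipschitz.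
by move=> y; have /andP[c0 c1] := clamp01 y; rewrite ger0_norm.
Qed.

Lemma regular_action (P : pred (profile A)) : regular (fun s : S => (P s.1 : nat)%:R).
Proof.
split.
  have -> : (fun s : S => (P s.1 : nat)%:R : R) =
      fun s => \sum_(al | P al) \1_[set t : S | t.1 = al] s.
    apply/funext => s; case: (boolP (P s.1)) => Ps.
      rewrite (bigD1 s.1)//= indicE mem_set//= big1 ?addr0// => al /andP[_ als].
      by rewrite indicE memNset//=; apply/eqP; rewrite eq_sym.
    rewrite big1// => al Pal; rewrite indicE memNset//= => sal.
    by move: Ps; rewrite sal Pal.
  by apply: bounded_measurable_sum => al _; apply: bounded_measurable_indic; exact: measurable_action.
by move=> al x e e0; exists 1 => // y _; rewrite subrr normr0.
Qed.

End Regular.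

(** * Stationarity as an identity between expectations *)

Section Stationarity.
Context {R : realType} {I : finType} {A : I -> finType} (a0 : forall i, A i).
Notation S := (learning_space R a0).
Variable u : I -> profile A -> R.

Lemma measurable_to_state (d : measure_display) (T : measurableType d)
    (al : T -> profile A) (X : T -> Defs.coord A -> R) :
  (forall be, measurable [set t | al t = be]) ->
  (forall k, measurable_fun [set: T] (fun t => X t k)) ->
  measurable_fun [set: T] (fun t => (al t, X t) : S).
Proof.
move=> mal mX; apply: (@measurability _ _ T S setT _ (@ambient_gen R I A : set (set S))) => //.
move=> _ [B [[be ->]|[k [E [mE ->]]]] <-]; rewrite setTI; first exact: mal.
by have := mX k measurableT E mE; rewrite setTI.
Qed.

Lemma measurable_in_states : measurable ([set s | in_states s] : set S).
Proof.
have -> : ([set s | in_states s] : set S) = \bigcap_(i in [set: I])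
    ((\bigcap_(a in [set: A i]) [set s | 0 <= s.2 (Tagged A a)]) `&`
     [set s | \sum_(a : A i) s.2 (Tagged A a) = 1]).
  apply/seteqP; split=> s /= H i; first by move=> _; have [H1 H2] := H i; split=> // a _; exact: H1.
  by have [H1 H2] := H i Logic.I; split=> // a; exact: H1.
apply: fin_bigcap_measurable => // i _; apply: measurableI.
  apply: fin_bigcap_measurable => // a _.
  have : measurable_fun [set: S] (fun s : S => 0 <= s.2 (Tagged A a)).
    by apply: measurable_fun_ler => //; exact: measurable_coord.
  by move=> /(_ measurableT [set true] Logic.I); rewrite setTI.
have : measurable_fun [set: S] (fun s : S => \sum_(a : A i) s.2 (Tagged A a) == 1).
  apply: measurable_fun_eqr => //; apply: measurable_sum => a.
  exact: measurable_coord.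
move=> /(_ measurableT [set true] Logic.I); rewrite setTI.
by congr measurable; apply/seteqP; split=> s /eqP.
Qed.

Variables eps lam : R.

Definition clamped (s : S) : Defs.coord A -> R := fun k => clamp (s.2 k).

Definition choice_prob (be : profile A) (s : S) := next_prob lam (clamped s) be.

Definition update (be : profile A) (s : S) : S := (be, next_strat u eps (clamped s) be).

Lemma in_states_le1 (s : S) k : in_states s -> 0 <= s.2 k <= 1.
Proof.
case: k => i a /(_ i)[s0 s1]; rewrite s0/= -s1 (bigD1 a)//= lerDl.
by apply: sumr_ge0 => b _; exact: s0.
Qed.

Lemma clamped_in_states (s : S) : in_states s -> clamped s = s.2.
Proof. by move=> sD; apply/funext => k; rewrite /clamped clamp_id// in_states_le1. Qed.

Lemma kernel_transition (s : S) B : in_states s ->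
  Defs.kernel u eps lam s B = transition choice_prob update \1_B s.
Proof. by move=> sD; rewrite /transition /choice_prob /update clamped_in_states. Qed.

Lemma regular_clamped k : regular (clamped ^~ k).
Proof. exact: regular_clamp. Qed.

Lemma regular_choice_prob be : regular (choice_prob be).
Proof.
apply: regular_prod => i _; apply: regularD; last exact: regular_cst.
by apply: regularZ; exact: regular_clamped.
Qed.

Lemma bounded_choice_prob be : bounded_measurable (choice_prob be).
Proof. by case: (regular_choice_prob be). Qed.

Lemma measurable_next_strat (X : S -> Defs.coord A -> R) be :
  (forall k, measurable_fun [set: S] (X ^~ k)) ->
  measurable_fun [set: S] (fun s => (be, next_strat u eps (X s) be) : S).
Proof.
move=> mX; apply: measurable_to_state => [al|k].
  have [->|ne] := eqVneq be al.
    by rewrite (_ : [set _ | _] = setT)//; apply/seteqP.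
  rewrite (_ : [set _ | _] = set0)//; apply/seteqP; split=> // t /= e.
  by rewrite e eqxx in ne.
apply: measurable_funD => //; apply: measurable_funM => //.
exact: measurable_funB.
Qed.

Lemma measurable_update be : measurable_fun [set: S] (update be).
Proof.
by apply: measurable_next_strat => k; case: (regular_clamped k) => -[].
Qed.

Lemma measurable_kernel (B : set S) : measurable B ->
  measurable_fun [set: S] (fun s : S => Defs.kernel u eps lam s B).
Proof.
move=> mB; apply: measurable_sum => be; apply: measurable_funM.
  apply: measurable_prod => i _; apply: measurable_funD => //.
  by apply: measurable_funM => //; exact: measurable_coord.
have mT := measurable_next_strat be (@measurable_coord R I A a0).
have mI : measurable_fun [set: S] (\1_B : S -> R) by exact: measurable_indic.
exact: (measurableT_comp mI mT).
Qed.

Lemma expect_kernel (mu : probability S R) (B : set S) :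
  mu (~` [set s : S | in_states s]) = 0%E -> measurable B ->
  (\int[mu]_s (Defs.kernel u eps lam s B)%:E =
   (\int[mu]_s transition choice_prob update \1_B s)%:E)%E.
Proof.
move=> mu0 mB.
have bt : bounded_measurable (transition choice_prob update (\1_B : S -> R)).
  apply: bounded_measurable_transition; [exact: bounded_choice_prob
    | exact: measurable_update | exact: bounded_measurable_indic].
rewrite -bounded_measurable_EFin//; apply: ae_eq_integral => //.
- by apply/measurable_EFinP; exact: measurable_kernel.
- by apply/measurable_EFinP; case: bt.
exists (~` [set s : S | in_states s]); split=> //.
  by apply: measurableC; exact: measurable_in_states.
by move=> s /= ns sD; apply: ns => _; rewrite kernel_transition.
Qed.

(** The measure does not charge the complement of the states, so under the integral the kernel may
    be replaced by the clamped operator, which preserves bounded measurable functions. *)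
Lemma invariantP (mu : probability S R) : Defs.invariant u eps lam mu <->
  mu (~` [set s : S | in_states s]) = 0%E /\
  forall B, measurable B ->
    \int[mu]_s \1_B s = \int[mu]_s transition choice_prob update \1_B s.
Proof.
split=> [[mu0 inv]|[mu0 inv]]; split=> // B mB.
  by apply: EFin_inj; rewrite -expect_kernel// -inv// expect_indic// fineK//; exact: fin_num_measure.
transitivity ((fine (mu B))%:E); first by rewrite fineK//; exact: fin_num_measure.
by rewrite expect_kernel// -inv// expect_indic.
Qed.

End Stationarity.

(** * The first-order effect of one tremble *)

(** When the product on the right is expanded, the left side keeps the terms with at most one factor
    [y]; all others are nonnegative. *)
Lemma prodrD_ge (R : realType) (I : finType) (x y : I -> R) :
  (forall i, 0 <= x i) -> (forall i, 0 <= y i) ->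
  \prod_i x i + \sum_i y i * \prod_(j | j != i) x j <= \prod_i (x i + y i).
Proof.
move=> x0 y0; have := index_enum_uniq I; elim: (index_enum I) => [|a r IH] /=.
  by rewrite !big_nil addr0.
move=> /andP[ar /IH {}IH]; rewrite !big_cons eqxx /=.
have xr0 : 0 <= \prod_(j <- r) x j by exact: prodr_ge0.
have -> : \prod_(j <- r | j != a) x j = \prod_(j <- r) x j.
  rewrite big_seq_cond [RHS]big_seq; apply: eq_bigl => j.
  by case: (boolP (j \in r)) => //= jr; apply: contraNneq ar => <-.
have -> : \sum_(i <- r) y i * \prod_(j <- a :: r | j != i) x j =
    x a * \sum_(i <- r) y i * \prod_(j <- r | j != i) x j.
  rewrite mulr_sumr [LHS]big_seq [RHS]big_seq; apply: eq_bigr => i ir.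
  rewrite big_cons (_ : (a != i)); last by apply: contraNneq ar => ->.
  by rewrite mulrCA.
set Q := \sum_(i <- r) _ in IH *.
have Q0 : 0 <= Q.
  by apply: sumr_ge0 => i _; rewrite mulr_ge0// prodr_ge0.
apply: le_trans (_ : (x a + y a) * (\prod_(j <- r) x j + Q) <= _); last first.
  by rewrite ler_wpM2l// addr_ge0.
by have := mulr_ge0 (y0 a) Q0; lra.
Qed.

Lemma bernoulli_onem (R : realType) (l : R) n : 0 <= l <= 1 ->
  1 - n%:R * l <= (1 - l) ^+ n.
Proof.
move=> /andP[l0 l1]; elim: n => [|n IH]; first by rewrite mul0r subr0.
have l10 : 0 <= 1 - l by rewrite subr_ge0.
rewrite exprS; apply: le_trans (ler_wpM2l l10 IH).
rewrite -natr1; have := mulr_ge0 (ler0n R n) (mulr_ge0 l0 l0); nra.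
Qed.

Lemma expect_le_in (d : measure_display) (T : measurableType d) (R : realType)
    (mu : probability T R) (D : set T) (f g : T -> R) :
  measurable D -> mu (~` D) = 0%E ->
  bounded_measurable f -> bounded_measurable g ->
  (forall s, D s -> f s <= g s) -> \int[mu]_s f s <= \int[mu]_s g s.
Proof.
move=> mD muD bf bg fg.
have bD h : bounded_measurable h -> bounded_measurable (fun s => h s * \1_D s : R).
  by move=> bh; apply: bounded_measurableM => //; exact: bounded_measurable_indic.
have restrict h : bounded_measurable h -> \int[mu]_s h s = \int[mu]_s (h s * \1_D s).
  move=> bh; congr fine; apply: ae_eq_integral => //.
  - by apply/measurable_EFinP; case: bh.
  - by apply/measurable_EFinP; case: (bD h bh).
  exists (~` D); split=> //; first exact: measurableC.
  by move=> s /= ns sD; apply: ns => _; rewrite indicE mem_set// mulr1.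
rewrite (restrict f)// (restrict g)//; apply: expect_le; try exact: bD.
move=> s; rewrite indicE; case: (boolP (s \in D)) => sD; last by rewrite !mulr0.
by rewrite !mulr1; apply: fg; exact: set_mem.
Qed.

Section Tremble.
Context {R : realType} {I : finType} {A : I -> finType} (a0 : forall i, A i).
Notation S := (learning_space R a0).
Variables (u : I -> profile A -> R) (eps : R).
Hypothesis valid : valid_eps u eps.

Definition in_box (x : Defs.coord A -> R) := forall k, 0 <= x k <= 1.

Lemma next_strat_in_box x be : in_box x -> in_box (next_strat u eps x be).
Proof.
move=> xb k; have /andP[v0 v1] := valid (tag k) be; have /andP[x0 x1] := xb k.
rewrite /next_strat; move: (eps * _) (x k) v0 v1 x0 x1 => v y v0 v1 y0 y1.
have h1 : 0 <= v * y by rewrite mulr_ge0// ltW.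
have h2 : 0 <= v * (1 - y) by rewrite mulr_ge0 ?subr_ge0// ltW.
have h3 : 0 <= (1 - v) * y by rewrite mulr_ge0 ?subr_ge0// ltW.
have h4 : 0 <= (1 - v) * (1 - y) by rewrite mulr_ge0 ?subr_ge0// ltW.
by case: (_ == _) => /=; apply/andP; split; lra.
Qed.

Lemma clamped_in_box (s : S) : in_box (clamped s).
Proof. by move=> k; exact: clamp01. Qed.

Variables (F : (Defs.coord A -> R) -> R) (M : R).
Hypotheses (M0 : 0 < M) (F0M : forall x, in_box x -> 0 <= F x <= M)
  (Freg : forall y : S -> Defs.coord A -> R, (forall k, regular (y ^~ k)) ->
    (forall s, in_box (y s)) -> regular (fun s => F (y s))).

Let f (s : S) := F (clamped s).

(** The one-tremble operator [L]: the weight [lam (1 - lam)^(n-1)] is left out, and [#|A i|^-1] is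
    the uniform choice of the trembling player. *)
Definition tremble (s : S) := \sum_i (#|A i|%:R^-1 *
  \sum_(be : profile A) (\prod_(j | j != i) clamped s (Tagged A (be j))) *
    F (next_strat u eps (clamped s) be)).

Lemma regular_f : regular f.
Proof. by apply: Freg => *; [exact: regular_clamped | exact: clamped_in_box]. Qed.

Lemma regular_tremble : regular tremble.
Proof.
apply: regular_sum => i _; apply: regularZ; apply: regular_sum => be _.
apply: regularM; first by apply: regular_prod => j _; exact: regular_clamped.
apply: Freg => [k|s]; last exact/next_strat_in_box/clamped_in_box.
apply: regularD; first exact: regular_clamped.
apply: regularZ; apply: regularD; first exact: regular_cst.
by under eq_fun do rewrite -mulN1r; apply: regularZ; exact: regular_clamped.
Qed.

Definition subharmonic := forall x : Defs.coord A -> R, in_box x ->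
  (forall i, \sum_(a : A i) x (Tagged A a) = 1) ->
  F x <= \sum_(be : profile A) (\prod_i x (Tagged A (be i))) * F (next_strat u eps x be).

Hypothesis Fsub : subharmonic.

(** [prodrD_ge] bounds the choice probabilities below. The term without tremble is treated by
    subharmonicity; the terms with two or more trembles are dropped, as [F >= 0]. *)
Lemma transition_ge lam (s : S) : 0 < lam < 1 -> in_states s ->
  (1 - lam) ^+ #|I| * f s + lam * (1 - lam) ^+ #|I|.-1 * tremble s <=
  transition (choice_prob lam) (update u eps) f s.
Proof.
move=> /andP[l0 l1] sD; set x := clamped s.
have xb : in_box x by exact: clamped_in_box.
have xs i : \sum_(a : A i) x (Tagged A a) = 1.
  by rewrite /x clamped_in_states//; case: (sD i).
have ->: transition (choice_prob lam) (update u eps) f s =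
    \sum_be next_prob lam x be * F (next_strat u eps x be).
  apply: eq_bigr => be _; congr (_ * F _); apply/funext => k.
  by rewrite /clamped /= clamp_id// next_strat_in_box.
apply: (@le_trans _ _ (\sum_(be : profile A) ((1 - lam) ^+ #|I| * \prod_i x (Tagged A (be i)) +
    lam * (1 - lam) ^+ #|I|.-1 * \sum_i #|A i|%:R^-1 *
      \prod_(j | j != i) x (Tagged A (be j))) * F (next_strat u eps x be))).
  under eq_bigr do rewrite mulrDl -mulrA -[X in _ + X]mulrA.
  rewrite big_split /= -!mulr_sumr lerD//.
    by rewrite ler_wpM2l ?exprn_ge0 ?subr_ge0 ?(ltW l1)//; exact: Fsub.
  rewrite le_eqVlt; apply/orP; left; apply/eqP; congr (_ * _).
  under [RHS]eq_bigr do rewrite mulr_suml.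
  rewrite exchange_big; apply: eq_bigr => i _; rewrite mulr_sumr.
  by apply: eq_bigr => be _; rewrite mulrA.
apply: ler_sum => be _; apply: ler_wpM2r.
  by have /F0M/andP[] := next_strat_in_box be xb.
have x0 i : 0 <= (1 - lam) * x (Tagged A (be i)).
  by rewrite mulr_ge0 ?subr_ge0 ?(ltW l1)//; have /andP[] := xb (Tagged A (be i)).
have y0 (i : I) : 0 <= lam / #|A i|%:R by rewrite divr_ge0 ?ler0n// ltW.
have := prodrD_ge x0 y0; apply: le_trans.
rewrite big_split /= prodr_const lerD//.
rewrite mulr_sumr; apply: ler_sum => i _.
rewrite big_split /= prodr_const cardC1 le_eqVlt; apply/orP; left; apply/eqP.
by ring.
Qed.

(** Integrating [transition_ge] against a stationary measure gives [lam (1 - lam)^(n-1) E[L f] <= (1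
    - (1 - lam)^n) E[f]]. The last bracket is at most [n lam] by Bernoulli's inequality, and [lam]
    cancels. *)
Lemma tremble_le lam (mu : probability S R) : 0 < lam < 1 ->
  Defs.invariant u eps lam mu ->
  (1 - lam) ^+ #|I|.-1 * \int[mu]_s tremble s <= #|I|%:R * \int[mu]_s f s.
Proof.
move=> l01 /invariantP[muD inv]; have /andP[l0 l1] := l01.
have [bf _] := regular_f; have [bt _] := regular_tremble.
have bp := bounded_choice_prob (A := A) a0 lam.
have mup := measurable_update (a0 := a0) u eps.
have stat : \int[mu]_s f s = \int[mu]_s transition (choice_prob lam) (update u eps) f s.
  (* Stationarity of expectations is available for functions with values in [[0, 1]], hence the
     rescaling. *)
  pose g s := M^-1 * f s.
  have bg : bounded_measurable g.
    by apply: bounded_measurableM => //; exact: bounded_measurable_cst.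
  have : \int[mu]_s g s = \int[mu]_s transition (choice_prob lam) (update u eps) g s.
    apply: stationary_expect => //; first by case: bg.
    move=> s; have /F0M/andP[Fs0 FsM] := clamped_in_box s.
    rewrite /g mulr_ge0 ?invr_ge0 ?(ltW M0)//=.
    by rewrite mulrC ler_pdivrMr// mul1r.
  have -> : transition (choice_prob lam) (update u eps) g =
      fun s => M^-1 * transition (choice_prob lam) (update u eps) f s.
    apply/funext => s; rewrite /transition mulr_sumr.
    by apply: eq_bigr => be _; rewrite mulrCA.
  rewrite !expectZ//; last exact: bounded_measurable_transition.
  by move/mulfI; apply; rewrite invr_neq0// gt_eqF.
have Ef0 : 0 <= \int[mu]_s f s.
  by apply: Rintegral_ge0 => s _; have /F0M/andP[] := clamped_in_box s.
have : (1 - lam) ^+ #|I| * \int[mu]_s f s +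
    lam * (1 - lam) ^+ #|I|.-1 * \int[mu]_s tremble s <= \int[mu]_s f s.
  rewrite [leRHS]stat -!expectZ// -expectD//; last 2 first.
  - by apply: bounded_measurableM => //; exact: bounded_measurable_cst.
  - by apply: bounded_measurableM => //; exact: bounded_measurable_cst.
  apply: (expect_le_in (@measurable_in_states R I A a0) muD).
  - by apply: bounded_measurableD; apply: bounded_measurableM => //; exact: bounded_measurable_cst.
  - exact: bounded_measurable_transition.
  - by move=> s; exact: transition_ge.
have l01' : 0 <= lam <= 1 by rewrite !ltW.
have bern := bernoulli_onem #|I| l01'.
have := ler_wpM2r Ef0 bern => h1 h2.
rewrite -(ler_pM2l l0); lra.
Qed.

Lemma limit_tremble_le (pi : profile A -> R) (mu : R -> probability S R) :
  limit_vector a0 u eps pi ->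
  (forall lam, 0 < lam < 1 -> Defs.invariant u eps lam (mu lam)) ->
  \sum_al pi al * tremble (pure_state R al) <=
  #|I|%:R * \sum_al pi al * f (pure_state R al).
Proof.
move=> [_ [_ lim]] inv.
have cvgE g : regular g -> \int[mu lam]_s g s @[lam --> 0^'+] -->
    \sum_al pi al * g (pure_state R al).
  move=> [[mg bg] cg]; apply: fine_cvg; exact: lim.
have c1 : (1 - lam) ^+ #|I|.-1 * \int[mu lam]_s tremble s @[lam --> 0^'+] -->
    (1 - 0) ^+ #|I|.-1 * \sum_al pi al * tremble (pure_state R al).
  apply: cvgM; last exact/cvgE/regular_tremble.
  apply: cvg_trans (_ : _ --> ((1 - 0) ^+ #|I|.-1 : R)).
    exact: cvg_refl.
  have c : (1 - lam : R) @[lam --> 0^'+] --> (1 - 0 : R).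
    by apply: cvgB; [exact: cvg_cst | exact: cvg_at_right_filter].
  elim: (_.-1) => [|n IH]; first by under eq_fun do rewrite expr0; exact: cvg_cst.
  by under eq_fun do rewrite exprS; rewrite exprS; exact: cvgM.
have c2 : #|I|%:R * \int[mu lam]_s f s @[lam --> 0^'+] -->
    #|I|%:R * \sum_al pi al * f (pure_state R al).
  by apply: cvgM; [exact: cvg_cst | exact/cvgE/regular_f].
rewrite subr0 expr1n mul1r in c1.
apply: (ler_cvg_to c1 c2); near=> lam; apply: tremble_le.
  by apply/andP; split; near: lam; [exact: nbhs_right_gt | exact: nbhs_right_lt].
by apply: inv; apply/andP; split; near: lam; [exact: nbhs_right_gt | exact: nbhs_right_lt].
Unshelve. all: by end_near. Qed.

End Tremble.

(** * The potential *)

Section Deviations.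
Context {I : finType} {A : I -> finType}.
Implicit Types al be : profile A.

Lemma profileP al be : (forall j : I, al j = be j) -> al = be.
Proof. by move=> ab; apply/(@ffunP I (fun i => A i) al be). Qed.

Lemma dev_same al i (a : A i) : dev al a i = a.
Proof. by rewrite ffunE dfwithin. Qed.

Lemma dev_other al i j (a : A i) : j != i -> dev al a j = al j.
Proof. by move=> ji; rewrite ffunE dfwithout// eq_sym. Qed.

Lemma dev_inj al i : injective (@dev I A al i).
Proof. by move=> a b /(congr1 (fun be : profile A => be i)); rewrite !dev_same. Qed.

Lemma eq_dev al be i : (forall j, j != i -> be j = al j) -> be = dev al (be i).
Proof.
move=> ab; apply: profileP => j; have [->|ji] := eqVneq j i; first by rewrite dev_same.
by rewrite dev_other// ab.
Qed.

Lemma dev_dev al i (a b : A i) : dev (dev al a) b = dev al b.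
Proof.
apply: profileP => j; have [->|ji] := eqVneq j i; first by rewrite !dev_same.
by rewrite !dev_other.
Qed.

(** Distinct actions of [i] give distinct profiles, so the left side is a partial sum of the right
    side. *)
Lemma sum_dev_le (R : realType) al i (G : profile A -> R) : (forall be, 0 <= G be) ->
  \sum_(b : A i) G (dev al b) <= \sum_be G be.
Proof.
move=> G0; pose D := [set dev al b | b in A i]%SET.
have -> : \sum_(b : A i) G (dev al b) = \sum_(be in D) G be.
  by rewrite big_imset//= => a b _ _; exact: dev_inj.
by rewrite [leRHS](bigID (mem D)) /= lerDl; exact: sumr_ge0.
Qed.

End Deviations.

(** * Subharmonic building blocks: a saturating fraction and high powers *)

Lemma max0_lipschitz (R : realType) (p q : R) :
  `|Num.max 0 p - Num.max 0 q| <= `|p - q|.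
Proof.
wlog pq : p q / p <= q => [H|].
  by have [/H//|/ltW/H] := leP p q; rewrite distrC [X in _ <= X]distrC.
rewrite distrC [X in _ <= X]distrC [X in _ <= X]ger0_norm ?subr_ge0//.
by rewrite ger0_norm; case: (leP 0 p); case: (leP 0 q) => *; lra.
Qed.

Section Frac.
Context {R : realType} (a : R).
Hypothesis a0 : 0 < a.

(** Increasing and concave on the nonnegative reals, with value [1/2] at [a]. For [a] proportional
    to the step size, the mass gained in a single step already has a value of order one. *)
Definition frac (y : R) := y / (y + a).

Lemma frac_ge0 y : 0 <= y -> 0 <= frac y.
Proof. by move=> y0; rewrite divr_ge0// addr_ge0// ltW. Qed.

Lemma frac_le1 y : 0 <= y -> frac y <= 1.
Proof. by move=> y0; rewrite ler_pdivrMr ?mul1r ?lerDl ?ltW// ltr_wpDl. Qed.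

Lemma fracB y z : 0 <= y -> 0 <= z ->
  frac y - frac z = a * (y - z) / ((y + a) * (z + a)).
Proof.
by move=> y0 z0; rewrite /frac; field; apply/andP; split; rewrite gt_eqF// ltr_wpDl.
Qed.

(** Truncation at [0] stays away from the pole at [- a], which makes the composition Lipschitz on
    the whole line. *)
Lemma frac_lipschitz y z : 
  `|frac (Num.max 0 y) - frac (Num.max 0 z)| <= a^-1 * `|y - z|.
Proof.
have y0 : 0 <= Num.max 0 y by rewrite le_max lexx.
have z0 : 0 <= Num.max 0 z by rewrite le_max lexx.
rewrite fracB//; apply: le_trans (_ : a^-1 * `|Num.max 0 y - Num.max 0 z| <= _); last first.
  by rewrite ler_wpM2l ?max0_lipschitz// invr_ge0 ltW.
move: (Num.max 0 y) (Num.max 0 z) y0 z0 => {}y {}z y0 z0.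
have p0 : 0 < (y + a) * (z + a) by rewrite mulr_gt0// ltr_wpDl.
rewrite normrM normfV (gtr0_norm p0) normrM (gtr0_norm a0) ler_pdivrMr// mulrAC ler_wpM2r//.
rewrite mulrC -ler_pdivrMr ?invr_gt0// invrK.
by rewrite ler_pM// ?(ltW a0)// lerDr.
Qed.

(* Concavity of [frac] makes an upward move [d] less effective than a downward
   move [d']; the gap [d - d'] makes up for it exactly when [a (d - d') >= d d']. *)
Lemma frac_drop_le w d d' : 0 <= w <= 1 -> 0 <= d' -> d' <= d -> d <= 1 ->
  d * d' <= a * (d - d') ->
  a * d / ((w + d * (1 - w) + a) * (w + a)) * - w <= frac (w + d' * (0 - w)) - frac w.
Proof.
move=> /andP[w0 w1] d'0 d'd d1 dd'.
have d0 := le_trans d'0 d'd.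
have y0 : 0 <= w + d' * (0 - w).
  have : 0 <= w * (1 - d') by rewrite mulr_ge0// subr_ge0 (le_trans d'd).
  by lra.
rewrite fracB//.
have p1 : 0 < w + d * (1 - w) + a by rewrite ltr_wpDl// addr_ge0// mulr_ge0// subr_ge0.
have p2 : 0 < w + d' * (0 - w) + a by rewrite ltr_wpDl.
have p3 : 0 < w + a by rewrite ltr_wpDl.
rewrite -subr_ge0.
have -> : a * (w + d' * (0 - w) - w) / ((w + d' * (0 - w) + a) * (w + a)) -
    a * d / ((w + d * (1 - w) + a) * (w + a)) * - w =
    a * w / (w + a) * ((d - d') * w + (a * (d - d') - d * d')) /
     ((w + d' * (0 - w) + a) * (w + d * (1 - w) + a)).
  by field; move: p2; rewrite sub0r => p2; rewrite !gt_eqF.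
rewrite divr_ge0//; last by rewrite mulr_ge0// ltW.
rewrite mulr_ge0//; first by rewrite divr_ge0 ?mulr_ge0// ltW.
by rewrite addr_ge0 ?mulr_ge0 ?subr_ge0.
Qed.

(** A draw in [B] moves the mass [w] up by [d (1 - w)]; a draw [j] outside moves it down by
    [e j * w]. The former contribute exactly [w (1 - w) P], the latter at least [- (1 - w) w P] by
    [frac_drop_le], and the two cancel. *)
Lemma frac_subharmonic (J : finType) (B : pred J) (x e : J -> R) d :
  (forall j, 0 <= x j) -> \sum_j x j = 1 -> 0 <= d <= 1 ->
  (forall j, B j -> e j = d) ->
  (forall j, ~~ B j -> [/\ 0 <= e j, e j <= d & d * e j <= a * (d - e j)]) ->
  forall w, w = \sum_(j | B j) x j ->
  frac w <= \sum_j x j * frac (w + e j * ((B j : nat)%:R - w)).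
Proof.
move=> x0 x1 /andP[d0 d1] eB eN w wE.
have w0 : 0 <= w by rewrite wE sumr_ge0.
have wC : \sum_(j | ~~ B j) x j = 1 - w by rewrite -x1 [in RHS](bigID B) /= -wE addrAC subrr add0r.
have w1 : w <= 1 by rewrite -subr_ge0 -wC sumr_ge0.
have -> : frac w = \sum_j x j * frac w by rewrite -mulr_suml x1 mul1r.
rewrite -subr_ge0 -sumrB; under eq_bigr do rewrite -mulrBr.
pose P := a * d / ((w + d * (1 - w) + a) * (w + a)).
rewrite (bigID B) /=.
have -> : \sum_(j | B j) x j * (frac (w + e j * ((B j : nat)%:R - w)) - frac w) =
    w * (P * (1 - w)).
  rewrite [in RHS]wE mulr_suml -wE; apply: eq_bigr => j Bj; rewrite Bj eB//=; congr (_ * _).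
  rewrite fracB//; last by rewrite addr_ge0// mulr_ge0// subr_ge0.
  by rewrite /P; ring.
rewrite addrC -lerBlDr sub0r.
apply: le_trans (_ : \sum_(j | ~~ B j) x j * (P * - w) <= _).
  by rewrite -mulr_suml wC; lra.
apply: ler_sum => j NBj; rewrite (negbTE NBj) /= ler_wpM2l//.
by have [e0 ed ded] := eN j NBj; apply: frac_drop_le; rewrite ?w0.
Qed.

End Frac.

(** With probability [X] the action is repeated and its weight is multiplied by [1 + d (1 - X) / X].
    By Bernoulli's inequality the [k]-th power of this factor is at least [1 + (1 - X) / X = 1 / X],
    which pays for the probability [X]. *)
Lemma power_gain (R : realType) (X d : R) k : 0 <= X <= 1 -> 0 <= d <= 1 ->
  1 <= k%:R * d -> X ^+ k <= X * (X + d * (1 - X)) ^+ k.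
Proof.
move=> /andP[X0 X1] /andP[d0 d1] kd.
have k0 : (0 < k)%N by case: k kd => //; rewrite mul0r; lra.
have [X00|/eqP X0'] := eqVneq X 0; first by rewrite X00 mul0r expr0n gtn_eqF.
have Xp : 0 < X by rewrite lt_neqAle eq_sym X0 andbT; exact/eqP.
have bern (t : R) n : 0 <= t -> 1 + n%:R * t <= (1 + t) ^+ n.
  move=> t0; elim: n => [|n IH]; first by rewrite mul0r addr0.
  rewrite exprS; have t1 : 0 <= 1 + t by rewrite addr_ge0.
  apply: le_trans (ler_wpM2l t1 IH); rewrite -natr1.
  by have := mulr_ge0 (ler0n R n) (mulr_ge0 t0 t0); lra.
have -> : X + d * (1 - X) = X * (1 + d * (1 - X) / X) by field; exact/eqP.
rewrite exprMn mulrCA ler_peMr ?exprn_ge0//.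
have t0 : 0 <= d * (1 - X) / X by rewrite divr_ge0// mulr_ge0// subr_ge0.
have := bern _ k t0 => /(ler_wpM2l X0); apply: le_trans.
have -> : X * (1 + k%:R * (d * (1 - X) / X)) = X + k%:R * d * (1 - X) by field; exact/eqP.
have : 0 <= (k%:R * d - 1) * (1 - X) by rewrite mulr_ge0// subr_ge0.
by lra.
Qed.

Lemma loss_le (R : realType) (P b f C l : R) :
  P <= b * f -> b * f * l <= C * l -> P - C * l <= b * ((1 - l) * f).
Proof. by lra. Qed.

(** * Welfare ranks, and the potential as a maximum of bumps *)

Section Potential.
Context {R : realType} {I : finType} {A : I -> finType} (a0 : forall i, A i).
Notation S := (learning_space R a0).
Variable u : I -> profile A -> R.
Hypothesis coord : coordination_game u.
Implicit Types (al be : profile A) (x : Defs.coord A -> R).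

Definition best_replyb i al (a : A i) :=
  [forall b : A i, u i (dev al b) <= u i (dev al a)].

Lemma best_replyP i al (a : A i) : reflect (best_reply u al a) (best_replyb al a).
Proof. exact: forallP. Qed.

Lemma best_replyb_dev i al (a b : A i) : best_replyb (dev al a) b = best_replyb al b.
Proof. by apply: eq_forallb => c; rewrite !dev_dev. Qed.

Lemma best_reply_exists i al : exists a : A i, best_replyb al a.
Proof.
pose b := [arg max_(b > al i) u i (dev al b)]%O.
by exists b; apply/forallP => c; rewrite /b; case: arg_maxP => // ? _; exact.
Qed.

Definition welfare al := \sum_j u j al.
(** An integer substitute for welfare, at most the number of profiles: a strict improvement, however
    small, gains a full factor [B] in the potential. *)
Definition rank al := #|[set be | welfare be < welfare al]%SET|.

Lemma rank_le al be : welfare al <= welfare be -> (rank al <= rank be)%N.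
Proof.
move=> Wab; apply: subset_leq_card; apply/fintype.subsetP => ga; rewrite !inE.
by move=> /lt_le_trans; exact.
Qed.

Lemma rank_lt al be : welfare al < welfare be -> (rank al < rank be)%N.
Proof.
move=> Wab; apply: proper_card; apply/fintype.properP; split.
  by apply/fintype.subsetP => ga; rewrite !inE => /lt_trans; exact.
by exists al; rewrite !inE// ltxx.
Qed.

Lemma best_reply_welfare i al (a : A i) : best_replyb al a ->
  welfare al <= welfare (dev al a).
Proof. by move=> /best_replyP ba; apply: ler_sum => j _; exact: coord.2. Qed.

(** Player [i] gains strictly, as its current action is not a best reply, and the coordination
    property lets nobody lose. *)
Lemma better_reply_welfare i al (a : A i) : best_replyb al a -> ~~ best_replyb al (al i) ->
  welfare al < welfare (dev al a).
Proof.
move=> ba nb; rewrite /welfare (bigD1 i)//= [ltRHS](bigD1 i)//= ltr_leD//.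
  move: nb; rewrite negb_forall => /existsP[b]; rewrite -ltNge => lt.
  have {1}-> : al = dev al (al i) by exact: eq_dev.
  by apply: lt_le_trans lt _; exact: (forallP ba).
by apply: ler_sum => j _; apply: coord.2; exact/best_replyP.
Qed.

Variables (eps c m : R) (k : nat) (B : R).
Hypotheses (valid : valid_eps u eps) (eps0 : 0 < eps) (c0 : 0 < c) (m0 : 0 < m)
  (um : forall i al, m <= u i al)
  (cu : forall i al be, u i be < u i al -> u i al * u i be <= c * (u i al - u i be))
  (kP : 1 <= k%:R * (eps * m)) (B1 : 1 <= B).

(** For the update sizes [d = eps u] and [d' = eps u'], the condition [d d' <= a (d - d')] of
    [frac_drop_le] becomes [u u' <= c (u - u')], which is free of [eps] and is the hypothesis
    [cu]. *)
Let a : R := c * eps.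
Let a_gt0 : 0 < a. Proof. exact: mulr_gt0. Qed.

Definition reply_mass al i x := \sum_(b : A i | best_replyb al b) x (Tagged A b).

(** The value does not depend on [al i]: best replies are determined by the actions of the other
    players. The exponent [k] is there for [power_gain]. *)
Definition bump al i x :=
  frac a (reply_mass al i x) * \prod_(j | j != i) x (Tagged A (al j)) ^+ k.

Definition potential x :=
  \big[Num.max/0]_(z : profile A * I | best_replyb z.1 (z.1 z.2))
    (B ^+ rank z.1 * bump z.1 z.2 x).

Let B0 : 0 <= B. Proof. exact: le_trans B1. Qed.

Lemma reply_mass_ge0 al i x : in_box x -> 0 <= reply_mass al i x.
Proof. by move=> xb; apply: sumr_ge0 => b _; have /andP[] := xb (Tagged A b). Qed.

Lemma bump01 al i x : in_box x -> 0 <= bump al i x <= 1.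
Proof.
move=> xb; have w0 := reply_mass_ge0 al i xb.
have p0 : 0 <= \prod_(j | j != i) x (Tagged A (al j)) ^+ k.
  by apply: prodr_ge0 => j _; rewrite exprn_ge0//; have /andP[] := xb (Tagged A (al j)).
have p1 : \prod_(j | j != i) x (Tagged A (al j)) ^+ k <= 1.
  apply: (@le_trans _ _ (\prod_(j | j != i) 1)); last by rewrite big1_eq.
  apply: ler_prod => j _; have /andP[x0 x1] := xb (Tagged A (al j)).
  by rewrite exprn_ge0//= exprn_ile1.
by rewrite mulr_ge0 ?frac_ge0//= mulr_ile1 ?frac_ge0 ?frac_le1.
Qed.

Definition potential_bound := B ^+ #|{: profile A}|.

Lemma potential_ge0 x : 0 <= potential x.
Proof. exact: bigmax_ge_id. Qed.

Lemma potential_le x : in_box x -> 0 <= potential x <= potential_bound.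
Proof.
move=> xb; rewrite potential_ge0/=; apply: bigmax_le => [|[al i] /= _].
  by rewrite exprn_ge0.
have /andP[b0 b1] := bump01 al i xb.
rewrite (le_trans (ler_piMr _ b1))// ?exprn_ge0//.
by apply: ler_weXn2l => //; exact: max_card.
Qed.

Lemma bump_le_potential al i x : best_replyb al (al i) ->
  B ^+ rank al * bump al i x <= potential x.
Proof.
move=> b; exact: (le_bigmax_cond _ (fun z : profile A * I =>
  B ^+ rank z.1 * bump z.1 z.2 x) (j := (al, i)) b).
Qed.

Lemma regular_potential (y : S -> Defs.coord A -> R) : (forall k, regular (y ^~ k)) ->
  (forall s, in_box (y s)) -> regular (fun s => potential (y s)).
Proof.
move=> ry yb; apply: regular_bigmax => -[al i] /= _; apply: regularZ.
apply: regularM; last by apply: regular_prod => j _; exact: regular_exp.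
have -> : (fun s => frac a (reply_mass al i (y s))) =
    fun s => frac a (Num.max 0 (reply_mass al i (y s))).
  by apply/funext => s; rewrite (max_idPr _)// reply_mass_ge0.
apply: (regular_comp (frac_lipschitz a_gt0)).
exact: regular_sum.
Qed.

Lemma reply_mass_next al i (b : A i) x :
  reply_mass al i (next_strat u eps x (dev al b)) =
  reply_mass al i x + eps * u i (dev al b) *
    ((best_replyb al b : nat)%:R - reply_mass al i x).
Proof.
rewrite /reply_mass /next_strat /= big_split /= -mulr_sumr sumrB; congr (_ + _ * (_ - _)).
case: (boolP (best_replyb al b)) => /= bb.
  rewrite (bigD1 b)//= dev_same eqxx big1 ?addr0// => b' /andP[_ /negbTE].
  by move=> ->.
rewrite big1// => b' b'b; rewrite dev_same; case: eqP => // e.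
by rewrite e (negbTE bb) in b'b.
Qed.

Lemma next_strat_other al i j (b : A i) x : j != i ->
  next_strat u eps x (dev al b) (Tagged A (al j)) =
  x (Tagged A (al j)) + eps * u j (dev al b) * (1 - x (Tagged A (al j))).
Proof. by move=> ji; rewrite /next_strat /= dev_other// eqxx. Qed.

(** Only the profiles where all players but [i] follow [al] are kept. There both the probability and
    the bump factor over the players: [frac_subharmonic] treats player [i] and [power_gain] each of
    the others. *)
Lemma bump_subharmonic al i x : best_replyb al (al i) -> in_box x ->
  (forall i, \sum_(a : A i) x (Tagged A a) = 1) ->
  bump al i x <=
  \sum_(be : profile A) (\prod_j x (Tagged A (be j))) * bump al i (next_strat u eps x be).
Proof.
move=> bal xb x1.
have x0 t : 0 <= x t by have /andP[] := xb t.
have nb be := next_strat_in_box valid be xb.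
apply: le_trans (sum_dev_le al i _); last first.
  by move=> be; rewrite mulr_ge0 ?prodr_ge0//; have /andP[] := bump01 al i (nb be).
pose w := reply_mass al i x.
apply: le_trans (_ : \sum_(b : A i) x (Tagged A b) *
    frac a (w + eps * u i (dev al b) * ((best_replyb al b : nat)%:R - w)) *
    \prod_(j | j != i) x (Tagged A (al j)) ^+ k <= _).
  rewrite -mulr_suml ler_wpM2r//; first by apply: prodr_ge0 => j _; rewrite exprn_ge0.
  apply: (frac_subharmonic a_gt0 (d := eps * u i al)) => //.
  - by have /andP[v0 v1] := valid i al; rewrite !ltW.
  (* All best replies yield the payoff [u i al], since [al i] is one of them; hence they share the
     update size [d]. *)
  - move=> b bb; congr (_ * _); apply: le_anti; apply/andP; split.
      rewrite [in leRHS](_ : al = dev al (al i)); last exact: eq_dev.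
      exact: (forallP bal).
    rewrite [in leLHS](_ : al = dev al (al i)); last exact: eq_dev.
    exact: (forallP bb).
  move=> b nbb; have /andP[v0 v1] := valid i (dev al b).
  have lt : u i (dev al b) < u i al.
    rewrite [ltRHS](_ : _ = u i (dev al (al i))); last by rewrite -eq_dev.
    move: nbb; rewrite negb_forall => /existsP[b']; rewrite -ltNge => /lt_le_trans.
    by apply; exact: (forallP bal).
  rewrite ltW// ler_pM2l// ltW//; split=> //.
  have -> : eps * u i al * (eps * u i (dev al b)) = eps * eps * (u i al * u i (dev al b)).
    by rewrite mulrACA.
  have -> : a * (eps * u i al - eps * u i (dev al b)) =
      eps * eps * (c * (u i al - u i (dev al b))).
    by rewrite /a -mulrBr mulrACA [in LHS]mulrC [c * eps]mulrC; ring.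
  by rewrite ler_pM2l ?mulr_gt0// cu.
apply: ler_sum => b _.
rewrite [X in _ <= X * _](bigD1 i)//= dev_same /bump reply_mass_next -/w -mulrA -[leRHS]mulrA.
rewrite ler_wpM2l// [leRHS]mulrCA ler_wpM2l//.
  by have := reply_mass_ge0 al i (nb (dev al b)); rewrite reply_mass_next; exact: frac_ge0.
rewrite -big_split /=; apply: ler_prod => j ji.
rewrite exprn_ge0//= dev_other// next_strat_other//.
apply: power_gain => //.
  by have /andP[v0 v1] := valid j (dev al b); rewrite !ltW.
by rewrite (le_trans kP)// ler_wpM2l ?ler0n// ler_wpM2l// ltW.
Qed.

(** A maximum of subharmonic functions is subharmonic: each bump is dominated by the potential at
    every successor. *)
Lemma potential_subharmonic : subharmonic u eps potential.
Proof.
move=> x xb x1; have x0 t : 0 <= x t by have /andP[] := xb t.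
have nb be := next_strat_in_box valid be xb.
apply: bigmax_le => [|[al i] /= bal].
  by apply: sumr_ge0 => be _; rewrite mulr_ge0 ?prodr_ge0 ?potential_ge0.
apply: (le_trans (ler_wpM2l (exprn_ge0 (rank al) B0) (bump_subharmonic bal xb x1))).
rewrite mulr_sumr; apply: ler_sum => be _; rewrite mulrCA ler_wpM2l ?prodr_ge0//.
exact: bump_le_potential.
Qed.


(** * Potential and trembles at pure states *)

Notation pure al := (pure_state R al).2.

Lemma pure_in_box al : in_box (pure al).
Proof. by move=> t; rewrite /=; case: (_ == _); rewrite /= ?lexx ?ler01. Qed.

Lemma clamped_pure al : clamped (pure_state R al : S) = pure al.
Proof. by apply/funext => t; rewrite /clamped clamp_id//; exact: pure_in_box. Qed.

Lemma reply_mass_pure al be i :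
  reply_mass be i (pure al) = (best_replyb be (al i) : nat)%:R.
Proof.
rewrite /reply_mass /=; case: (boolP (best_replyb _ _)) => b.
  by rewrite (bigD1 (al i))//= eqxx big1 ?addr0// => b' /andP[_ /negbTE ->].
by rewrite big1// => b' bb'; case: eqP => // e; rewrite -e bb' in b.
Qed.

Let k0 : (0 < k)%N.
Proof. by case: k kP => //; rewrite mul0r; lra. Qed.

(** At a pure state only those bumps survive whose profile [be] agrees with [al] off [i] and admits
    [al i] as a best reply. Then [al] arises from [be] by a best reply, so its rank is at least that
    of [be]. *)
Lemma potential_pure_le al : potential (pure al) <= B ^+ rank al * frac a 1.
Proof.
have f1 : 0 <= frac a 1 by exact: frac_ge0.
apply: bigmax_le => [|[be i] /= _]; first by rewrite mulr_ge0 ?exprn_ge0.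
have [eqab|] := boolP [forall j, (j != i) ==> (be j == al j)]; last first.
  rewrite negb_forall => /existsP[j]; rewrite negb_imply => /andP[ji nbe].
  rewrite /bump (bigD1 j)//= (negbTE nbe) expr0n gtn_eqF// mul0r !mulr0.
  by rewrite mulr_ge0 ?exprn_ge0.
have eqba j : j != i -> al j = be j.
  by move=> ji; have := forallP eqab j; rewrite ji => /eqP.
rewrite /bump reply_mass_pure; case: (boolP (best_replyb be (al i))) => /= b; last first.
  by rewrite /frac mul0r mul0r mulr0 mulr_ge0 ?exprn_ge0.
rewrite big1 ?mulr1 => [|j ji]; last by rewrite eqba// eqxx expr1n.
rewrite ler_wpM2r// ler_weXn2l//; apply: rank_le.
by rewrite [in leRHS](eq_dev eqba); exact: best_reply_welfare.
Qed.

(** The other players sit at unit vectors and repeat these actions, so only the reply mass of [i]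
    moves. The action [a'] is free because a bump ignores the action of its own player. *)
Lemma bump_after_tremble al i (a' b : A i) :
  bump (dev al a') i (next_strat u eps (pure al) (dev al b)) =
  frac a ((best_replyb al (al i) : nat)%:R +
    eps * u i (dev al b) * ((best_replyb al b : nat)%:R - (best_replyb al (al i) : nat)%:R)).
Proof.
rewrite /bump big1 => [|j ji]; last first.
  by rewrite dev_other// next_strat_other//= eqxx subrr mulr0 addr0 expr1n.
rewrite mulr1 -[X in reply_mass (dev al a') i (next_strat _ _ _ X)](dev_dev al a' b).
by rewrite reply_mass_next reply_mass_pure !best_replyb_dev dev_dev.
Qed.

(** At a pure state the players who do not tremble repeat their actions with probability one, so
    unilateral deviations carry weight one. *)
Lemma tremble_pure_ge al :
  \sum_i #|A i|%:R^-1 * \sum_(b : A i) potential (next_strat u eps (pure al) (dev al b)) <=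
  tremble u eps potential (pure_state R al : S).
Proof.
rewrite /tremble clamped_pure; apply: ler_sum => i _.
rewrite ler_wpM2l ?invr_ge0 ?ler0n//.
apply: le_trans (sum_dev_le al i _); last first.
  move=> be; apply: mulr_ge0; last exact: potential_ge0.
  by apply: prodr_ge0 => j _; have /andP[] := pure_in_box al (Tagged A (be j)).
apply: ler_sum => b _; rewrite big1 ?mul1r// => j ji.
by rewrite /= dev_other// eqxx.
Qed.

Lemma card_action_gt0 i : 0 < #|A i|%:R :> R.
Proof. by rewrite ltr0n; apply/card_gt0P; exists (a0 i). Qed.

(** Each player [i] best replies, so after its tremble the mass of its best replies is still at
    least [1 - U eps]. The bump of [al] at [i], which attains the bound of [potential_pure_le]
    before the tremble, thus loses at most a fraction [U eps]. *)
Lemma tremble_NE (U : R) al : 0 <= U -> (forall i be, u i be <= U) -> pure_NE u al ->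
  #|I|%:R * potential (pure al) - #|I|%:R * potential_bound * U * eps <=
  tremble u eps potential (pure_state R al : S).
Proof.
move=> U0 uU ne; apply: le_trans (tremble_pure_ge al).
have [D DE] : exists D, D = potential (pure al) - potential_bound * U * eps by eexists.
apply: le_trans (_ : \sum_(i : I) D <= _).
  have -> : \sum_(i : I) D = #|I|%:R * D by rewrite mulr_natl; exact: sumr_const.
  by rewrite DE mulrBr !mulrA.
apply: ler_sum => i _.
have -> : D = #|A i|%:R^-1 * \sum_(b : A i) D.
  have -> : \sum_(b : A i) D = #|A i|%:R * D by rewrite mulr_natl; exact: sumr_const.
  by rewrite mulKf// gt_eqF// card_action_gt0.
rewrite ler_wpM2l ?invr_ge0 ?ler0n//; apply: ler_sum => b _.
have ba : best_replyb al (al i) by exact/best_replyP.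
apply: le_trans (bump_le_potential _ ba).
have /andP[v0 v1] := valid i (dev al b).
have -> : bump al i (next_strat u eps (pure al) (dev al b)) =
    bump (dev al (al i)) i (next_strat u eps (pure al) (dev al b)) by rewrite -eq_dev.
rewrite bump_after_tremble ba /=.
set w := (1 + _).
have w01 : 1 - U * eps <= w <= 1.
  have Ue : eps * u i (dev al b) <= U * eps by rewrite mulrC ler_wpM2r// ltW.
  by rewrite /w; case: (best_replyb _ _) => /=; apply/andP; split; lra.
have w0 : 0 <= w by rewrite /w; case: (best_replyb _ _) => /=; lra.
have /andP[wU w1] := w01.
(* The ratio of [frac a w] to [w] is [1 / (w + a)], which is decreasing, and [w <= 1]. *)
have fw : w * frac a 1 <= frac a w.
  rewrite /frac mul1r ler_wpM2l// lef_pV2 ?posrE ?ltr_wpDl//.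
  by rewrite lerD2r.
have f0 : 0 <= frac a 1 by exact: frac_ge0.
have f1 : frac a 1 <= 1 by exact: frac_le1.
have Br : 0 <= B ^+ rank al by rewrite exprn_ge0.
have BN : B ^+ rank al <= potential_bound by apply: ler_weXn2l => //; exact: max_card.
have pB := potential_pure_le al.
apply: le_trans (ler_wpM2l Br fw).
apply: le_trans (_ : B ^+ rank al * ((1 - U * eps) * frac a 1) <= _); last first.
  by rewrite ler_wpM2l// ler_wpM2r.
have Ue0 : 0 <= U * eps by rewrite mulr_ge0// ltW.
have : B ^+ rank al * frac a 1 * (U * eps) <= potential_bound * (U * eps).
  by rewrite ler_wpM2r// (le_trans _ BN)// ler_piMr.
by move=> loss; rewrite DE -(mulrA potential_bound); apply: loss_le.
Qed.

(** A dissatisfied player [i] trembles to a best reply [b] with probability [1 / #|A i|], and the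
    bump of [dev al b] at [i] jumps from zero to order one. Its rank exceeds that of [al], and the
    extra factor [B] pays for [#|A i|], for [m / (m + c)] and for [n + 1]. *)
Lemma tremble_not_NE al : (forall i, #|I|.+1%:R * #|A i|%:R * (m + c) <= B * m) ->
  ~ pure_NE u al ->
  #|I|%:R * potential (pure al) + 1 <= tremble u eps potential (pure_state R al : S).
Proof.
move=> Bbig nne; apply: le_trans (tremble_pure_ge al).
have [i nbi] : exists i, ~ best_reply u al (al i) by apply/existsNP => H; apply: nne.
have nb : ~~ best_replyb al (al i) by apply/negP => /best_replyP.
have [b bb] := best_reply_exists i al.
have terms_ge0 j : 0 <= #|A j|%:R^-1 *
    \sum_(b : A j) potential (next_strat u eps (pure al) (dev al b)).
  by rewrite mulr_ge0 ?invr_ge0 ?ler0n// sumr_ge0// => ? _; exact: potential_ge0.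
rewrite (bigD1 i)//=; apply: ler_wpDr; first exact: sumr_ge0.
apply: le_trans (_ : #|A i|%:R^-1 * potential (next_strat u eps (pure al) (dev al b)) <= _); last first.
  rewrite ler_wpM2l ?invr_ge0 ?ler0n// (bigD1 b)//= lerDl.
  by apply: sumr_ge0 => ? _; exact: potential_ge0.
have bdev : best_replyb (dev al b) (dev al b i) by rewrite dev_same best_replyb_dev.
have := bump_le_potential (next_strat u eps (pure al) (dev al b)) bdev.
rewrite bump_after_tremble bb (negbTE nb) /= add0r subr0 mulr1 => le1.
have rk : (rank al < rank (dev al b))%N by apply: rank_lt; exact: better_reply_welfare.
have Br : 1 <= B ^+ rank al by exact: exprn_ege1.
have Br0 : 0 <= B ^+ rank al by rewrite exprn_ge0.
have p0 := card_action_gt0 i.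
rewrite [leRHS]mulrC ler_pdivlMr//; apply: le_trans le1.
have mc : 0 < m + c by exact: addr_gt0.
(* As [a = c eps], the step size cancels: the right side is [u / (u + c)], which increases with
   [u >= m]. *)
have fr : m / (m + c) <= frac a (eps * u i (dev al b)).
  rewrite /frac /a (_ : eps * u i (dev al b) + c * eps = eps * (u i (dev al b) + c)); last by ring.
  have uc : 0 < u i (dev al b) + c by rewrite addr_gt0// coord.1.
  rewrite -mulf_div divff ?gt_eqF// mul1r ler_pdivrMr// mulrAC ler_pdivlMr//.
  by rewrite !mulrDr [m * u i _]mulrC lerD2l ler_pM2r.
have m_mc : 0 <= m / (m + c) by rewrite divr_ge0// ltW.
have BB : B ^+ rank al * B <= B ^+ rank (dev al b) by rewrite -exprSr ler_weXn2l.
apply: le_trans (_ : B ^+ rank al * B * (m / (m + c)) <= _); last first.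
  by rewrite ler_pM// mulr_ge0.
have pP : potential (pure al) <= B ^+ rank al.
  rewrite (le_trans (potential_pure_le al))// ler_piMr//; exact: frac_le1.
(* Both the potential at [al] and the constant [1] are at most [B ^ rank al], whence the factor
   [n + 1]. *)
apply: le_trans (_ : #|I|.+1%:R * B ^+ rank al * #|A i|%:R <= _).
  rewrite ler_pM2r// -natr1 mulrDl mul1r lerD//.
  by rewrite ler_wpM2l ?ler0n.
by rewrite -!mulrA mulrCA ler_wpM2l// mulrA ler_pdivlMr.
Qed.

End Potential.

(** * Realising a consistent family of word probabilities on the unit interval *)

Section Words.
Context {R : realType} {E : finType}.
Implicit Types (w : seq E) (h : seq E -> R).

Fixpoint wsum (n : nat) h : R :=
  if n is n'.+1 then \sum_a wsum n' (fun w => h (a :: w)) else h [::].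

Lemma eq_wsum n h h' : (forall w, size w = n -> h w = h' w) -> wsum n h = wsum n h'.
Proof.
elim: n h h' => [|n IH] h h' hh /=; first exact: hh.
by apply: eq_bigr => a _; apply: IH => w wn; apply: hh; rewrite /= wn.
Qed.

(** The last letter is the newest action; stationarity is checked by separating it from its past. *)
Lemma wsum_rcons n h : wsum n.+1 h = wsum n (fun w => \sum_a h (rcons w a)).
Proof.
elim: n h => [//|n IH] h.
rewrite -[LHS]/(\sum_a wsum n.+1 (fun w => h (a :: w))).
rewrite -[RHS]/(\sum_a wsum n (fun w => \sum_b h (a :: rcons w b))).
by apply: eq_bigr => a _; rewrite IH.
Qed.

Lemma ler_wsum n h h' : (forall w, size w = n -> h w <= h' w) -> wsum n h <= wsum n h'.
Proof.
elim: n h h' => [|n IH] h h' hh /=; first exact: hh.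
by apply: ler_sum => a _; apply: IH => w wn; apply: hh; rewrite /= wn.
Qed.

Lemma wsumB n h h' : wsum n (fun w => h w - h' w) = wsum n h - wsum n h'.
Proof.
elim: n h h' => [//|n IH] h h' /=.
by rewrite -sumrB; apply: eq_bigr => a _; rewrite IH.
Qed.

Lemma wsumZ n (c : R) h : wsum n (fun w => c * h w) = c * wsum n h.
Proof.
elim: n h => [//|n IH] h /=.
by rewrite mulr_sumr; apply: eq_bigr => a _; rewrite IH.
Qed.

Lemma wsum_norm n h : `|wsum n h| <= wsum n (fun w => `|h w|).
Proof.
elim: n h => [//|n IH] h /=.
by rewrite (le_trans (ler_norm_sum _ _ _))//; apply: ler_sum.
Qed.

Lemma wsum_pick n h w : size w = n -> wsum n (fun v => h v * (w == v)%:R) = h w.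
Proof.
elim: n h w => [|n IH] h [|a w]//=; first by rewrite mulr1.
move=> [wn]; rewrite (bigD1 a)//= (_ : wsum _ _ = h (a :: w)).
  rewrite big1 ?addr0// => b ba; rewrite (eq_wsum (h' := fun=> 0 * 0)).
    by rewrite wsumZ mul0r.
  by move=> v _; rewrite eqseq_cons eq_sym (negbTE ba) mulr0 mul0r.
rewrite -[RHS](IH (fun v => h (a :: v)) w wn); apply: eq_wsum => v _.
by rewrite eqseq_cons eqxx.
Qed.

Lemma bounded_measurable_wsum (d : measure_display) (T : measurableType d) n
    (H : T -> seq E -> R) : (forall w, bounded_measurable (H ^~ w)) ->
  bounded_measurable (fun t => wsum n (H t)).
Proof.
elim: n H => [|n IH] H bH /=; first exact: bH.
by apply: bounded_measurable_sum => a _; exact: IH.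
Qed.

Lemma expect_wsum (d : measure_display) (T : measurableType d) (mu : probability T R) n
    (H : T -> seq E -> R) : (forall w, bounded_measurable (H ^~ w)) ->
  \int[mu]_t wsum n (H t) = wsum n (fun w => \int[mu]_t H t w).
Proof.
elim: n H => [//|n IH] H bH /=.
rewrite expect_sum => [|a _]; last exact: bounded_measurable_wsum.
by apply: eq_bigr => a _; exact: IH.
Qed.

End Words.

(** * Nested subdivisions of the unit interval *)

Section Locate.
Context {R : realType} {E : eqType} (e0 : E) (f : E -> R).
Hypothesis f0 : forall a, 0 <= f a.

(** The letters of [s] receive consecutive half-open intervals of lengths [f b] starting at [0]; the
    default [e0] is reached only to the right of all of them. *)
Fixpoint locate (s : seq E) (t : R) : E :=
  if s is b :: s' then (if t < f b then b else locate s' (t - f b)) else e0.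

Fixpoint offset (s : seq E) (a : E) : R :=
  if s is b :: s' then (if a == b then 0 else f b + offset s' a) else 0.

Lemma offset_ge0 s a : 0 <= offset s a.
Proof. by elim: s => //= b s IH; case: ifP => // _; rewrite addr_ge0. Qed.

Lemma offset_le s a : a \in s -> offset s a + f a <= \sum_(b <- s) f b.
Proof.
elim: s => //= b s IH; rewrite inE big_cons; case: eqP => [->|_] /= ain.
  by rewrite add0r lerDl sumr_ge0.
by rewrite -addrA lerD2l IH.
Qed.

Lemma locate_in s t : t < \sum_(b <- s) f b -> 0 <= t -> locate s t \in s.
Proof.
elim: s t => [|b s IH] t /=; first by rewrite big_nil => /lt_le_trans/[apply]; rewrite ltxx.
rewrite big_cons => tb t0; case: (ltP t (f b)) => tfb; rewrite inE ?eqxx// IH ?orbT//.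
  by rewrite ltrBlDl.
by rewrite subr_ge0.
Qed.

Lemma locateP s t a : uniq s -> 0 <= t < \sum_(b <- s) f b -> a \in s ->
  (locate s t == a) = (offset s a <= t < offset s a + f a).
Proof.
elim: s t => [//|b s IH] t /= /andP[bs us] /andP[t0]; rewrite big_cons inE => tb.
have [->|ab] /= := eqVneq a b.
  rewrite t0 add0r; case: (ltP t (f b)) => tfb _; first by rewrite eqxx.
  apply/negbTE; apply: contraNneq bs => <-; apply: locate_in; first by rewrite ltrBlDl.
  by rewrite subr_ge0.
move=> ain; case: (ltP t (f b)) => tfb.
  rewrite eq_sym (negbTE ab); symmetry; apply/negbTE; rewrite negb_and -ltNge.
  by rewrite (lt_le_trans tfb)// lerDl offset_ge0.
rewrite IH//; last by rewrite subr_ge0 tfb /= ltrBlDl.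
by rewrite lerBrDl ltrBlDl addrA.
Qed.

End Locate.

Section Coding.
Context {R : realType} {E : finType} (e0 : E) (q : seq E -> R).
Hypotheses (q0 : forall w, 0 <= q w) (q1 : q [::] = 1)
  (qS : forall w, \sum_a q (a :: w) = q w).

(** The word [w] owns a half-open interval of length [q w]. Those of the words [a :: w] subdivide
    it, in accordance with [qS]. *)
Fixpoint left_end (w : seq E) : R :=
  if w is a :: w' then left_end w' + offset (fun b => q (b :: w')) (enum E) a else 0.

(** Every real number receives a code in this way; the points moved to [0] are null for the uniform
    law. *)
Definition unit_part (t : R) : R := if 0 <= t < 1 then t else 0.

(* Words are chronological: each new letter is an older action, so that the
   words [code n t] describe longer and longer pasts. *)
Fixpoint code (n : nat) (t : R) : seq E :=
  if n is n'.+1 then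
    let w := code n' t in
    locate e0 (fun b => q (b :: w)) (enum E) (unit_part t - left_end w) :: w
  else [::].

Lemma size_code n t : size (code n t) = n.
Proof. by elim: n => //= n ->. Qed.

Lemma unit_part_itv t : 0 <= unit_part t < 1.
Proof. by rewrite /unit_part; case: ifP => // _; rewrite lexx ltr01. Qed.

Let sum_enum w : \sum_(b <- enum E) q (b :: w) = q w.
Proof. by rewrite -qS big_enum. Qed.

Lemma left_end_bounds w : 0 <= left_end w /\ left_end w + q w <= 1.
Proof.
elim: w => [|a w [IH0 IH1]] /=; first by rewrite q1 add0r.
split; first by rewrite addr_ge0// offset_ge0.
apply: le_trans IH1; rewrite -addrA lerD2l -[leRHS]sum_enum.
by rewrite (offset_le (fun b => q0 (b :: w)))// mem_enum.
Qed.

Lemma codeP n t w : size w = n ->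
  (code n t == w) = (left_end w <= unit_part t < left_end w + q w).
Proof.
elim: n w => [|n IH] [|a w]//=; first by rewrite q1 add0r unit_part_itv.
move=> [wn]; rewrite eqseq_cons.
have off0 := offset_ge0 (fun b => q0 (b :: w)) (enum E) a.
have offq : offset (fun b => q (b :: w)) (enum E) a + q (a :: w) <= q w.
  by rewrite -[leRHS]sum_enum (offset_le (fun b => q0 (b :: w)))// mem_enum.
case: (eqVneq (code n t) w) => [e|ne]; rewrite ?andbT ?andbF.
  rewrite e locateP ?enum_uniq ?mem_enum//; last first.
    by have /eqP := e; rewrite IH// sum_enum subr_ge0 ltrBlDl.
  by rewrite lerBrDl ltrBlDl addrA.
symmetry; apply/negbTE; move: ne; rewrite IH//; apply: contraNN => /andP[h1 h2].
by apply/andP; split; lra.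
Qed.

Lemma measurable_unit_part : measurable_fun [set: R] unit_part.
Proof.
apply: measurable_fun_ifT => //; apply: measurable_and.
  exact: measurable_fun_ler.
exact: measurable_fun_ltr.
Qed.

Lemma measurable_code n w : measurable [set t : R | code n t = w].
Proof.
have [wn|/eqP wn] := eqVneq (size w) n; last first.
  rewrite (_ : [set _ | _] = set0)//; apply/seteqP; split=> // t /= e.
  by apply: wn; rewrite -e size_code.
have : measurable_fun [set: R] (fun t => left_end w <= unit_part t < left_end w + q w).
  apply: measurable_and.
    by apply: measurable_fun_ler => //; exact: measurable_unit_part.
  by apply: measurable_fun_ltr => //; exact: measurable_unit_part.
move=> /(_ measurableT [set true] Logic.I); rewrite setTI.
congr measurable; apply/seteqP; split=> t /=; first by rewrite -(codeP t wn) => /eqP.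
by rewrite -(codeP t wn) => /eqP.
Qed.

Definition unif : probability _ R := uniform_prob (@ltr01 R).

Lemma unif_code n w : size w = n -> fine (unif [set t : R | code n t = w]) = q w.
Proof.
move=> wn; set B := [set t | _].
have mB : measurable B := measurable_code n w.
have -> : unif B = lebesgue_measure (B `&` `[0, 1]).
  transitivity (\int[unif]_t (\1_B t)%:E)%E; first by rewrite integral_indic// setIT.
  rewrite /unif integral_uniform//; last first.
    by apply/measurable_EFinP; exact: measurable_indic.
  by rewrite subr0 invr1 mul1e integral_indic.
have [l0 l1] := left_end_bounds w.
have sub1 : [set` `[left_end w, left_end w + q w[ ] `<=` B `&` `[0, 1].
  move=> t /=; rewrite in_itv /= => /andP[h1 h2].
  have t01 : 0 <= t < 1 by rewrite (le_trans l0)//= (lt_le_trans h2).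
  split; last by rewrite in_itv /=; case/andP: t01 => -> /ltW ->.
  by apply/eqP; rewrite codeP// /unit_part t01 h1.
(* The point [1] is sent to [0] by [unit_part], so it may belong to [B] without lying in the
   interval of [w]; it is null. *)
have sub2 : B `&` `[0, 1] `<=` [set` `[left_end w, left_end w + q w[ ] `|` [set 1].
  move=> t [/= /eqP]; rewrite codeP// /unit_part => + /= ; rewrite !in_itv /=.
  move=> + /andP[t0]; rewrite le_eqVlt => + /orP[/eqP ->|t1]; first by right.
  by rewrite t0 t1 /= => h; left.
have mI : measurable (B `&` `[0, 1]) by exact: measurableI.
have lI : lebesgue_measure ([set` `[left_end w, left_end w + q w[ ] : set R) = (q w)%:E.
  rewrite lebesgue_measure_itv /= lte_fin ltrDl.
  have [qw|qw] := ltP 0 (q w); first by rewrite -EFinD addrAC subrr add0r.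
  by congr EFin; apply: le_anti; rewrite q0 qw.
suff -> : lebesgue_measure (B `&` `[0, 1]) = (q w)%:E by [].
apply: le_anti; apply/andP; split.
  have mJ : measurable ([set` `[left_end w, left_end w + q w[ ] : set R).
    exact: measurable_itv.
  have m1 : measurable [set 1 : R] by exact: measurable_set1.
  have h1 := le_measure lebesgue_measure (mem_set mI) (mem_set (measurableU _ _ mJ m1)) sub2.
  have h2 := measureU2 lebesgue_measure mJ m1.
  apply: (le_trans h1); apply: (le_trans h2).
  by rewrite [X in (X + _ <= _)%E]lI [X in (_ + X <= _)%E]lebesgue_measure_set1 adde0.
by rewrite -lI; apply: le_measure => //; rewrite inE//; exact: measurable_itv.
Qed.

Lemma bounded_measurable_code n (h : seq E -> R) :
  bounded_measurable (fun t => h (code n t)).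
Proof.
have -> : (fun t => h (code n t)) =
    fun t => wsum n (fun w => h w * \1_[set t | code n t = w] t).
  apply/funext => t; rewrite -[LHS](wsum_pick h (size_code n t)).
  apply: eq_wsum => w _; rewrite indicE; congr (_ * (nat_of_bool _)%:R).
  by apply/eqP/idP => [e|/set_mem//]; exact: mem_set.
apply: bounded_measurable_wsum => w; apply: bounded_measurableM.
  exact: bounded_measurable_cst.
by apply: bounded_measurable_indic; exact: measurable_code.
Qed.

Lemma expect_code n (h : seq E -> R) :
  \int[unif]_t h (code n t) = wsum n (fun w => q w * h w).
Proof.
have -> : (fun t => h (code n t)) =
    fun t => wsum n (fun w => h w * \1_[set t | code n t = w] t).
  apply/funext => t; rewrite -[LHS](wsum_pick h (size_code n t)).
  apply: eq_wsum => w _; rewrite indicE; congr (_ * (nat_of_bool _)%:R).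
  by apply/eqP/idP => [e|/set_mem//]; exact: mem_set.
have bI w : bounded_measurable (\1_[set t : R | code n t = w] : R -> R).
  by apply: bounded_measurable_indic; exact: measurable_code.
rewrite expect_wsum => [|w]; last first.
  exact: (bounded_measurableM (bounded_measurable_cst (h w)) (bI w)).
apply: eq_wsum => w wn; rewrite (expectZ unif (h w) (bI w)).
by rewrite (expect_indic unif (measurable_code n w)) mulrC unif_code.
Qed.

End Coding.

(** * Stationary word probabilities *)

Lemma ultrafilter_image (T T' : Type) (f : T -> T') (U : set_system T) :
  UltraFilter U -> UltraFilter (f @ U).
Proof.
move=> UU; apply: Build_UltraFilter => G PG UG; apply/seteqP; split=> // B GB.
have [//|nB] := in_ultra_setVsetC (f @^-1` B) UU.
have GnB : G (~` B) by exact: UG.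
by have [x []] := filter_ex (filterI GB GnB).
Qed.

(** Compactness of [[0, 1]]. A single ultrafilter then serves all words at once, without extracting
    subsequences. *)
Lemma ultrafilter_cvg (R : realType) (U : set_system nat) (h : nat -> R) :
  UltraFilter U -> (forall n, 0 <= h n <= 1) -> exists l : R, h @ U --> l.
Proof.
move=> UU h01; have := @segment_compact R 0 1; rewrite compact_ultra => /(_ (h @ U)).
case; first exact: ultrafilter_image.
  have PU : ProperFilter U by exact: ultra_proper.
  by apply: (@filterE _ U) => n /=; rewrite in_itv /= h01.
by move=> l [_ hl]; exists l.
Qed.

Section WordProbabilities.
Context {R : realType} {E : finType} {X : Type}.
Variables (D : X -> Prop) (T : E -> X -> X) (p : E -> X -> R) (dl : nat -> R).

Definition run (x : X) (w : seq E) := foldl (fun y a => T a y) x w.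

Hypotheses (TD : forall a x, D x -> D (T a x))
  (p0 : forall a x, D x -> 0 <= p a x) (p1 : forall x, D x -> \sum_a p a x = 1)
  (pdl : forall a w x y, D x -> D y ->
    `|p a (run x w) - p a (run y w)| <= dl (size w)).

Fixpoint word_prob (x : X) (w : seq E) : R :=
  if w is a :: w' then p a x * word_prob (T a x) w' else 1.

(** Probability that the actions following the first [n] steps from [x] spell [w]. *)
Fixpoint delayed_prob (n : nat) (x : X) (w : seq E) : R :=
  if n is n'.+1 then \sum_a p a x * delayed_prob n' (T a x) w else word_prob x w.

Let p_le1 a x : D x -> p a x <= 1.
Proof.
by move=> Dx; rewrite -(p1 Dx) (bigD1 a)//= lerDl; apply: sumr_ge0 => b _; exact: p0.
Qed.

Lemma word_prob01 x w : D x -> 0 <= word_prob x w <= 1.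
Proof.
elim: w x => [|a w IH] x Dx /=; first by rewrite ler01 lexx.
have /andP[h0 h1] := IH _ (TD a Dx).
by rewrite mulr_ge0 ?p0//= mulr_ile1 ?p0 ?p_le1.
Qed.

Lemma delayed_prob01 n x w : D x -> 0 <= delayed_prob n x w <= 1.
Proof.
elim: n x => [|n IH] x Dx /=; first exact: word_prob01.
apply/andP; split.
  by apply: sumr_ge0 => a _; have /andP[h0 _] := IH _ (TD a Dx); rewrite mulr_ge0 ?p0.
rewrite -(p1 Dx); apply: ler_sum => a _; have /andP[_ h1] := IH _ (TD a Dx).
by rewrite ler_piMr ?p0.
Qed.

Lemma delayed_prob_nil n x : D x -> delayed_prob n x [::] = 1.
Proof.
elim: n x => [//|n IH] x Dx /=; rewrite -[RHS](p1 Dx).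
by apply: eq_bigr => a _; rewrite IH ?mulr1//; exact: TD.
Qed.

Lemma delayed_prob_cons n x w : \sum_a delayed_prob n x (a :: w) = delayed_prob n.+1 x w.
Proof.
elim: n x => [//|n IH] x; rewrite [LHS]exchange_big /=.
by apply: eq_bigr => a _; rewrite -mulr_sumr IH.
Qed.

Lemma word_prob_rcons x w a : word_prob x (rcons w a) = word_prob x w * p a (run x w).
Proof. by elim: w x => [|b w IH] x /=; rewrite ?mulr1 ?mul1r// IH mulrA. Qed.

(** The last action is drawn at a state reached by running [w] from some point; by [pdl], replacing
    that point by [x0] costs at most [dl (size w)]. *)
Lemma delayed_prob_rcons n x x0 w a : D x -> D x0 ->
  `|delayed_prob n x (rcons w a) - delayed_prob n x w * p a (run x0 w)| <=
  dl (size w) * delayed_prob n x w.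
Proof.
move=> + Dx0; elim: n x => [|n IH] x Dx /=.
  have /andP[w0 _] := word_prob01 w Dx.
  by rewrite word_prob_rcons -mulrBr normrM ger0_norm// mulrC ler_wpM2r// pdl.
rewrite mulr_suml -sumrB mulr_sumr (le_trans (ler_norm_sum _ _ _))//.
apply: ler_sum => b _; rewrite -mulrA -mulrBr normrM (ger0_norm (p0 b Dx)) mulrCA.
by rewrite ler_wpM2l ?p0// IH//; exact: TD.
Qed.

(** [q w] is the ultrafilter limit of the Cesaro means over [n] of the probability of [w] after [n]
    steps. Summing over a prepended letter shifts [n] by one, which the means do not see in the
    limit; the estimate on the last letter survives averaging. *)
Lemma stationary_words x0 : D x0 -> exists q : seq E -> R,
  [/\ forall w, 0 <= q w, q [::] = 1, forall w, \sum_a q (a :: w) = q w &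
      forall w a, `|q (rcons w a) - q w * p a (run x0 w)| <= dl (size w) * q w].
Proof.
move=> Dx0.
have [U [UU ooU]] := ultraFilterLemma eventually_filter.
have PU : ProperFilter U by exact: ultra_proper.
pose Q w (N : nat) : R := N.+1%:R^-1 * \sum_(n < N.+1) delayed_prob n x0 w.
have N0 (N : nat) : 0 < N.+1%:R :> R by rewrite ltr0n.
have Q01 w N : 0 <= Q w N <= 1.
  apply/andP; split.
    rewrite mulr_ge0 ?invr_ge0 ?ler0n// sumr_ge0// => n _.
    by have /andP[] := delayed_prob01 n w Dx0.
  rewrite /Q mulrC ler_pdivrMr// mul1r.
  apply: (@le_trans _ _ (\sum_(n < N.+1) 1)); last by rewrite sumr_const card_ord.
  by apply: ler_sum => n _; have /andP[] := delayed_prob01 n w Dx0.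
have /choice[q qP] : forall w, exists l : R, Q w @ U --> l.
  by move=> w; exact: ultrafilter_cvg.
have qE (h : nat -> R) (l l' : R) : h @ U --> l -> h @ U --> l' -> l = l'.
  by move=> hl hl'; exact: (cvg_unique (@Rhausdorff R) hl hl').
exists q; split.
- move=> w; apply: (ler_cvg_to (cvg_cst 0) (qP w)).
  by apply: filterE => N; have /andP[] := Q01 w N.
- apply: qE (qP [::]) _; rewrite (_ : Q [::] = fun=> 1); first exact: cvg_cst.
  apply/funext => N; rewrite /Q (eq_bigr (fun=> 1)) => [|n _]; last exact: delayed_prob_nil.
  by rewrite sumr_const card_ord mulVf// gt_eqF.
- move=> w; apply/eqP; rewrite -subr_eq0; apply/eqP.
  have c1 : (fun N => \sum_a Q (a :: w) N - Q w N) @ U --> \sum_a q (a :: w) - q w.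
    apply: cvgB; last exact: qP.
    elim: (index_enum E) => [|a r IH].
      by under eq_fun do rewrite big_nil; rewrite big_nil; exact: cvg_cst.
    by under eq_fun do rewrite big_cons; rewrite big_cons; apply: cvgD => //; exact: qP.
  (* The sum telescopes to the difference of two probabilities divided by [N + 1]. It vanishes along
     [\oo], hence along the finer filter [U]. *)
  have c2 : (fun N => \sum_a Q (a :: w) N - Q w N) @ U --> (0 : R).
    apply: (@cvg_trans _ ((fun N => \sum_a Q (a :: w) N - Q w N) @ \oo)).
      by move=> B; exact: ooU.
    apply/norm_cvg0P.
    apply: (@squeeze_cvgr _ _ _ _ (fun=> 0) (@harmonic R)); last 2 first.
    - exact: cvg_cst.
    - exact: cvg_harmonic.
    apply: nearW => N; rewrite normr_ge0 /= /Q -mulr_sumr -mulrBr exchange_big /=.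
    under eq_bigr do rewrite delayed_prob_cons.
    rewrite normrM ger0_norm ?invr_ge0 ?ler0n// /harmonic ler_piMr ?invr_ge0 ?ler0n//.
    rewrite -sumrB -(big_mkord xpredT (fun n => delayed_prob n.+1 x0 w - delayed_prob n x0 w)).
    rewrite telescope_sumr//.
    have /andP[h0 h1] := delayed_prob01 N.+1 w Dx0.
    have /andP[h2 h3] := delayed_prob01 0 w Dx0.
    by rewrite ler_norml; lra.
  exact: qE c1 c2.
- move=> w a.
  have c1 : (fun N => `|Q (rcons w a) N - Q w N * p a (run x0 w)|) @ U -->
      `|q (rcons w a) - q w * p a (run x0 w)|.
    by apply: cvg_norm; apply: cvgB; [exact: qP | apply: cvgM; [exact: qP | exact: cvg_cst]].
  have c2 : (fun N => dl (size w) * Q w N) @ U --> dl (size w) * q w.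
    by apply: cvgM; [exact: cvg_cst | exact: qP].
  apply: (ler_cvg_to c1 c2); apply: filterE => N; rewrite /Q.
  rewrite -mulrA -mulrBr normrM ger0_norm ?invr_ge0 ?ler0n// mulrCA.
  rewrite ler_wpM2l ?invr_ge0 ?ler0n// mulr_suml -sumrB mulr_sumr.
  rewrite (le_trans (ler_norm_sum _ _ _))//; apply: ler_sum => n _.
  exact: delayed_prob_rcons.
Qed.

End WordProbabilities.

(** * Existence of invariant measures *)

Section FromRegular.
Context {R : realType} {I : finType} {A : I -> finType} (a0 : forall i, A i).
Notation S := (learning_space R a0).
Variables (u : I -> profile A -> R) (eps lam : R).
Notation K := (transition (choice_prob (A := A) (a0 := a0) lam) (update u eps)).

(** A generating family stable under intersection. The conditions on the coordinates are closed, so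
    that the indicators are pointwise limits of regular functions. *)
Definition upper_set (P : pred (profile A)) (D : pred (Defs.coord A))
    (c : Defs.coord A -> R) : set S :=
  [set s | P s.1 /\ forall k, D k -> c k <= s.2 k].

Definition upper_sets : set (set S) :=
  [set B | exists P D c, B = upper_set P D c].

Lemma upper_sets_setI : setI_closed upper_sets.
Proof.
move=> _ _ [P [D [c ->]]] [P' [D' [c' ->]]].
exists (fun al => P al && P' al), (fun k => D k || D' k),
  (fun k => if D k then (if D' k then Num.max (c k) (c' k) else c k) else c' k).
apply/seteqP; split=> [s [[Ps cs] [Ps' cs']]|s [/andP[Ps Ps'] cs]].
  split=> [|k]; first by rewrite Ps.
  case Dk: (D k) => /=; last by move=> D'k; exact: cs'.
  by move=> _; case D'k: (D' k); rewrite ?ge_max ?cs ?cs'.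
split; split=> // k Dk; have := cs k; rewrite Dk ?orbT => /(_ isT).
  by case: (D' k) => //; rewrite ge_max => /andP[].
by case: (D k) => //; rewrite ge_max => /andP[].
Qed.

Lemma measurable_sub_upper_sets : (measurable : set (set S)) `<=` <<s upper_sets >>.
Proof.
apply: smallest_sub; first exact: smallest_sigma_algebra.
move=> B [[al ->]|[k [E [mE ->]]]].
  apply: sub_sigma_algebra; exists (pred1 al), pred0, (fun=> 0).
  by apply/seteqP; split=> [s /= sal|s [/eqP]//]; split=> //; exact/eqP.
pose S' := g_sigma_algebraType upper_sets.
have mk : measurable_fun [set: S'] (fun s : S' => (s : S).2 k : measurableTypeR R).
  apply: (measurability _ (RGenCInfty.measurableE R)) => _ [_ [x ->] <-].
  apply: sub_sigma_algebra; exists predT, (pred1 k), (fun=> x).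
  apply/seteqP; split=> [s [_ /=]|s [_ /= cs]].
    by rewrite in_itv /= andbT => xs; split=> // k' /eqP ->.
  by split=> //=; rewrite in_itv /= andbT; exact: cs.
by have := mk measurableT E mE; rewrite setTI.
Qed.

Lemma regular_upper_approx P D c : exists g : nat -> S -> R,
  [/\ forall n, regular (g n), forall n s, 0 <= g n s <= 1 &
      forall s, g n s @[n --> \oo] --> (\1_(upper_set P D c) s : R)].
Proof.
(* Equal to [1] for [y >= 0] and, when [n > 0], to [0] for [y <= - 1 / n]; it is Lipschitz with
   constant [n]. *)
pose h (n : nat) (y : R) := clamp (1 + n%:R * y).
have h01 n y : 0 <= h n y <= 1 by exact: clamp01.
exists (fun n s => (P s.1 : nat)%:R * \prod_(k | D k) h n (s.2 k - c k)).
have hprod n (s : S) : 0 <= \prod_(k | D k) h n (s.2 k - c k) <= 1.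
  apply/andP; split; first by apply: prodr_ge0 => k _; have /andP[] := h01 n (s.2 k - c k).
  apply: (@le_trans _ _ (\prod_(k | D k) 1)); last by rewrite big1_eq.
  by apply: ler_prod => k _; exact: h01.
split.
- move=> n; apply: regularM; first exact: regular_action.
  apply: regular_prod => k _.
  apply: (@regular_lipschitz_coord _ _ _ _ (fun y => h n (y - c k)) n%:R 1).
    move=> y z; rewrite (le_trans (clamp_lipschitz _ _))//.
    rewrite opprD addrACA subrr add0r -mulrBr opprB addrA subrK normrM ger0_norm ?ler0n//.
  by move=> y; have /andP[? ?] := h01 n (y - c k); rewrite ger0_norm.
- move=> n s; have /andP[l r] := hprod n s.
  by case: (P s.1); rewrite /= ?mul0r ?mul1r ?l ?r ?lexx ?ler01.
- move=> s.
  have [Ps|nPs] := boolP (P s.1); last first.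
    under eq_fun do rewrite mul0r; rewrite indicE memNset; first exact: cvg_cst.
    by case=> Ps _; rewrite Ps in nPs.
  have [/forallP cs|] := boolP [forall k, D k ==> (c k <= s.2 k)].
    rewrite indicE mem_set; last by split=> // k; have /implyP := cs k.
    rewrite [X in X @ _ --> _](_ : _ = fun=> 1); first exact: cvg_cst.
    apply/funext => n; rewrite mul1r big1// => k Dk; have /implyP/(_ Dk) ck := cs k.
    rewrite /h /clamp (max_idPr _) ?(min_idPl _)// ?lerDl ?addr_ge0 ?mulr_ge0 ?subr_ge0//.
  rewrite negb_forall => /existsP[k]; rewrite negb_imply -ltNge => /andP[Dk sk].
  rewrite indicE memNset; last by case=> _ /(_ k Dk); rewrite leNgt sk.
  pose y := c k - s.2 k; have y0 : 0 < y by rewrite subr_gt0.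
  apply: cvg_near_cst.
  near=> n; rewrite (bigD1 k)//=.
  suff -> : h n (s.2 k - c k) = 0 by rewrite mul0r mulr0.
  have ny : 1 <= n%:R * y.
    rewrite -ler_pdivrMr// mul1r; near: n; exact: nbhs_infty_ger.
  rewrite /h /clamp -[s.2 k - c k]opprB -/y mulrN (max_idPl _); first by rewrite (min_idPr _).
  by rewrite subr_le0.
Unshelve. all: by end_near. Qed.

Variable mu : probability S R.
Hypothesis regular_stat : forall g, regular g -> \int[mu]_s g s = \int[mu]_s K g s.

Let bK g : bounded_measurable g -> bounded_measurable (K g).
Proof.
apply: bounded_measurable_transition; [exact: bounded_choice_prob | exact: measurable_update].
Qed.

Lemma stationary_limit (g : nat -> S -> R) (B : set S) : measurable B ->
  (forall n, bounded_measurable (g n)) -> (forall n s, 0 <= g n s <= 1) ->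
  (forall s, g n s @[n --> \oo] --> (\1_B s : R)) ->
  (forall n, \int[mu]_s g n s = \int[mu]_s K (g n) s) ->
  \int[mu]_s \1_B s = \int[mu]_s K \1_B s.
Proof.
move=> mB bg g01 gB gE.
have bB : bounded_measurable (\1_B : S -> R) by exact: bounded_measurable_indic.
have c1 : \int[mu]_s g n s @[n --> \oo] --> \int[mu]_s \1_B s.
  apply: (@bounded_convergence _ _ _ mu g \1_B 1) => //; first by move=> n; case: (bg n).
  by move=> n s; have /andP[? ?] := g01 n s; rewrite ger0_norm.
have [C C0 dist] := transition_dist (update u eps) (bounded_choice_prob (A := A) a0 lam).
have c2 : \int[mu]_s K (g n) s @[n --> \oo] --> \int[mu]_s K \1_B s.
  apply: (@bounded_convergence _ _ _ mu (fun n => K (g n)) (K \1_B) C) => //.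
  - by move=> n; case: (bK (bg n)).
  - exact: bK.
  - move=> n s; have := dist (g n) (fun=> 0) 1 s ler01.
    rewrite (_ : K (fun=> 0) s = 0); last by rewrite /transition big1// => be _; rewrite mulr0.
    rewrite subr0 mulr1; apply => t; rewrite subr0.
    by have /andP[? ?] := g01 n t; rewrite ger0_norm.
  move=> s; rewrite /transition; elim: (index_enum _) => [|be r IH].
    by under eq_fun do rewrite big_nil; rewrite big_nil; exact: cvg_cst.
  under eq_fun do rewrite big_cons; rewrite big_cons; apply: cvgD => //.
  by apply: cvgM; [exact: cvg_cst | exact: gB].
rewrite (_ : (fun n => _) = fun n => \int[mu]_s K (g n) s) in c1; last exact/funext.
exact: (cvg_unique (@Rhausdorff R) c1 c2).
Qed.

(** Dynkin's pi-lambda theorem: the sets satisfying the identity form a lambda-system, which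
    contains the upper sets by bounded convergence. *)
Lemma stationary_of_regular (B : set S) : measurable B ->
  \int[mu]_s \1_B s = \int[mu]_s K \1_B s.
Proof.
pose H := [set B : set S | measurable B /\ \int[mu]_s \1_B s = \int[mu]_s K \1_B s].
have GH : upper_sets `<=` H.
  move=> _ [P [D [c ->]]]; have [g [rg g01 gc]] := regular_upper_approx P D c.
  have mB : measurable (upper_set P D c).
    apply/(measurable_indicP R); apply: (@measurable_fun_cvg _ _ _ _ g) => // n.
    by have [[]] := rg n.
  split=> //; apply: (stationary_limit mB _ g01 gc) => n; first by case: (rg n).
  exact: regular_stat.
have lH : lambda_system [set: S] H.
  split=> //.
  - apply: GH; exists predT, pred0, (fun=> 0); by apply/seteqP; split=> // s _.
  - move=> X Y YX [mX eX] [mY eY]; split; first exact: measurableD.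
    have bX := bounded_measurable_indic (R := R) mX.
    have bY := bounded_measurable_indic (R := R) mY.
    have -> : (\1_(X `\` Y) : S -> R) = fun s => \1_X s - \1_Y s.
      apply/funext => s; rewrite !indicE in_setD.
      case: (boolP (s \in Y)) => sY; last by rewrite andbT subr0.
      by rewrite andbF mem_set ?subrr//; apply: YX; exact: set_mem.
    have -> : K (fun s => \1_X s - \1_Y s) = fun s => K \1_X s - K \1_Y s.
      apply/funext => s; rewrite /transition -sumrB.
      by apply: eq_bigr => be _; rewrite mulrBr.
    by rewrite !expectB ?eX ?eY//; exact: bK.
  - move=> F ndF HF; have mF n : measurable (F n) by case: (HF n).
    have mU : measurable (\bigcup_n F n) by exact: bigcup_measurable.
    split=> //; apply: (@stationary_limit (fun n => \1_(F n))) => //.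
    + by move=> n; exact: bounded_measurable_indic.
    + by move=> n s; rewrite indicE; case: (_ \in _); rewrite /= ?lexx ?ler01.
    + move=> s; rewrite [X in _ --> X]indicE; case: (boolP (s \in _)) => sU.
        have [n _ Fns] := set_mem sU.
        apply: cvg_near_cst.
        near=> m; rewrite indicE mem_set//.
        have nm : (n <= m)%N by near: m; exact: nbhs_infty_ge.
        by have /subsetPset := ndF _ _ nm; apply.
      rewrite (_ : (fun n => _) = fun=> 0); first exact: cvg_cst.
      apply/funext => n; rewrite indicE memNset// => Fns.
      by move/negP: sU; apply; apply/mem_set; exists n.
    + by move=> n; case: (HF n).
move=> mB; suff : H B by case.
apply: (lambda_system_subset upper_sets_setI lH GH) => //.
exact: measurable_sub_upper_sets.
Unshelve. all: by end_near. Qed.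

End FromRegular.

(** * Products over players, geometric convergence and image laws *)

Lemma sum_profile_prod (R : realType) (I : finType) (A : I -> finType)
    (f : forall i, A i -> R) :
  \sum_(be : profile A) \prod_i f i (be i) = \prod_i \sum_a f i a.
Proof.
pose P i : {ffun A i -> R} := [ffun a => f i a].
have -> : \sum_(be : profile A) \prod_i f i (be i) =
    \sum_(t : fprod A) \prod_(i in I) P i (t i).
  rewrite (reindex (@dffun_of_fprod I A)); last exact/onW_bij/dffun_of_fprod_bij.
  by apply: eq_bigr => t _; apply: eq_bigr => i _; rewrite !ffunE.
rewrite big_fprod -(bigA_distr_big_dep (fun i => [pred j | tagged_with A i j])
  (fun i j => untag 0 (P i) j)).
apply: eq_bigr => i _; rewrite -(big_tag (fun i a => P i a)).
by apply: eq_bigr => a _; rewrite ffunE.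
Qed.

Lemma prodr_dist (R : realType) (I : finType) (f g : I -> R) :
  (forall i, 0 <= f i <= 1) -> (forall i, 0 <= g i <= 1) ->
  `|\prod_i f i - \prod_i g i| <= \sum_i `|f i - g i|.
Proof.
move=> f01 g01.
have prod01 (h : I -> R) r : (forall i, 0 <= h i <= 1) -> `|\prod_(i <- r) h i| <= 1.
  move=> h01; elim: r => [|i r IH]; first by rewrite big_nil normr1.
  rewrite big_cons normrM mulr_ile1//; have /andP[h0 h1] := h01 i.
  by rewrite ger0_norm.
elim: (index_enum I) => [|i r IH]; first by rewrite !big_nil subrr normr0.
rewrite !big_cons; set Pf := \prod_(j <- r) f j; set Pg := \prod_(j <- r) g j.
have -> : f i * Pf - g i * Pg = (f i - g i) * Pf + g i * (Pf - Pg) by ring.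
rewrite (le_trans (ler_normD _ _))// lerD// normrM.
  by rewrite ler_piMr// prod01.
have /andP[g0 g1] := g01 i; rewrite ger0_norm// (le_trans _ IH)//.
by rewrite ler_piMl.
Qed.

Lemma geometric_increments_cvg (R : realType) (h : nat -> R) (rho : R) :
  0 <= rho < 1 -> (forall n, `|h n.+1 - h n| <= rho ^+ n) -> cvgn h.
Proof.
move=> /andP[r0 r1] hr.
have gc : cvgn (series (geometric 1 rho)) by apply: is_cvg_geometric_series; rewrite ger0_norm.
have c : cvgn (series (telescope h)).
  apply: normed_cvg; apply: (series_le_cvg _ _ _ gc) => n //=.
  - by rewrite mul1r exprn_ge0.
  - by rewrite mul1r; exact: hr.
rewrite telescopeK in c.
have -> : h = fun n => (h n - h 0%N) + h 0%N by apply/funext => n; rewrite subrK.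
by apply: is_cvgD => //; exact: is_cvg_cst.
Qed.

Lemma law_exists (d d' : measure_display) (T : measurableType d) (T' : measurableType d')
    (R : realType) (P : probability T R) (Y : T -> T') : measurable_fun [set: T] Y ->
  exists mu : probability T' R, (forall B, mu B = P (Y @^-1` B)) /\
    forall g : T' -> R, bounded_measurable g -> \int[mu]_s g s = \int[P]_t g (Y t).
Proof.
move=> mY; pose Yf : {mfun T >-> T'} := HB.pack Y (isMeasurableFun.Build _ _ _ _ Y mY).
exists (distribution P Yf); split=> // g [mg [M gM]].
have bgY : bounded_measurable (fun t => g (Y t)).
  by split; [exact: (measurableT_comp mg mY) | exists M].
congr fine; rewrite integral_distribution//; first exact/measurable_EFinP.
exact: (bounded_measurable_integrable P bgY).
Qed.

Section Existence.
Context {R : realType} {I : finType} {A : I -> finType} (a0 : forall i, A i).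
Notation S := (learning_space R a0).
Variables (u : I -> profile A -> R) (eps lam : R).
Hypotheses (valid : valid_eps u eps) (lam01 : 0 < lam < 1).
Notation K := (transition (choice_prob (A := A) (a0 := a0) lam) (update u eps)).
Implicit Types x y : Defs.coord A -> R.

Definition mixed x := in_box x /\ forall i, \sum_(a : A i) x (Tagged A a) = 1.

Let T (be : profile A) x := next_strat u eps x be.
Let p (be : profile A) x := next_prob lam x be.

Let l0 : 0 < lam. Proof. by case/andP: lam01. Qed.
Let l1 : lam < 1. Proof. by case/andP: lam01. Qed.

Lemma mixed_next be x : mixed x -> mixed (T be x).
Proof.
move=> [xb x1]; split; first exact: next_strat_in_box.
move=> i; rewrite /T /next_strat /= big_split /= x1 -mulr_sumr sumrB x1.
rewrite (bigD1 (be i))//= eqxx big1 ?addr0 ?subrr ?mulr0 ?addr0// => a /negbTE ->.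
by [].
Qed.

Let choice01 i x (a : A i) : in_box x ->
  0 <= (1 - lam) * x (Tagged A a) + lam / #|A i|%:R <= 1.
Proof.
move=> xb; have /andP[x0 x1] := xb (Tagged A a).
have c1 : 1 <= #|A i|%:R :> R by rewrite ler1n; apply/card_gt0P; exists (a0 i).
have c0 : 0 < #|A i|%:R :> R by exact: lt_le_trans c1.
have h1 : lam / #|A i|%:R <= lam by rewrite ler_pdivrMr// ler_peMr// ltW.
have h2 : 0 <= lam / #|A i|%:R by rewrite divr_ge0// ltW.
have h3 : (1 - lam) * x (Tagged A a) <= 1 - lam by rewrite ler_piMr// subr_ge0 ltW.
have h4 : 0 <= (1 - lam) * x (Tagged A a) by rewrite mulr_ge0// subr_ge0 ltW.
by apply/andP; split; lra.
Qed.

Lemma next_prob_ge0 be x : in_box x -> 0 <= p be x.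
Proof. by move=> xb; apply: prodr_ge0 => i _; have /andP[] := choice01 (be i) xb. Qed.

Lemma sum_next_prob x : mixed x -> \sum_be p be x = 1.
Proof.
move=> [xb x1]; rewrite /p /next_prob.
rewrite (sum_profile_prod (fun i a => (1 - lam) * x (Tagged A a) + lam / #|A i|%:R)).
rewrite big1// => i _; rewrite big_split /= -mulr_sumr x1 mulr1.
have -> : \sum_(a : A i) lam / #|A i|%:R = #|A i|%:R * (lam / #|A i|%:R).
  by rewrite mulr_natl; exact: sumr_const.
have c0 : #|A i|%:R != 0 :> R.
  by rewrite pnatr_eq0 -lt0n; apply/card_gt0P; exists (a0 i).
by rewrite mulrCA divff// mulr1 subrK.
Qed.

(** For a fixed joint action the update is affine in each coordinate, with slope [1 - eps u]; the
    largest slope is a common Lipschitz constant. *)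
Definition contraction := \big[Num.max/0]_(z : I * profile A) (1 - eps * u z.1 z.2).
Notation rho := contraction.

Lemma contraction01 : 0 <= rho < 1.
Proof.
rewrite bigmax_ge_id/=; apply: bigmax_lt => // -[i be] _ /=.
by have /andP[v0 _] := valid i be; rewrite gtrBl.
Qed.

Lemma next_strat_dist be x y k : `|T be x k - T be y k| <= rho * `|x k - y k|.
Proof.
have -> : T be x k - T be y k = (1 - eps * u (tag k) be) * (x k - y k).
  by rewrite /T /next_strat; ring.
have /andP[v0 v1] := valid (tag k) be.
rewrite normrM ler_wpM2r// ger0_norm ?subr_ge0 ?(ltW v1)//.
exact: (le_bigmax _ (fun z : I * profile A => 1 - eps * u z.1 z.2) (tag k, be)).
Qed.

Lemma mixed_run x w : mixed x -> mixed (run T x w).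
Proof. by elim: w x => //= be w IH x /(mixed_next be)/IH. Qed.

Lemma run_dist x y w k : in_box x -> in_box y ->
  `|run T x w k - run T y w k| <= rho ^+ size w.
Proof.
move=> xb yb.
have /andP[r0 _] := contraction01.
suff h : `|run T x w k - run T y w k| <= rho ^+ size w * `|x k - y k|.
  rewrite (le_trans h)// ler_piMr ?exprn_ge0//.
  have /andP[? ?] := xb k; have /andP[? ?] := yb k; rewrite ler_norml; lra.
elim: w x y {xb yb} => [|be w IH] x y /=; first by rewrite mul1r.
rewrite (le_trans (IH _ _))// exprSr -mulrA ler_wpM2l ?exprn_ge0//.
exact: next_strat_dist.
Qed.

Lemma next_prob_run_dist be w x y : mixed x -> mixed y ->
  `|p be (run T x w) - p be (run T y w)| <= #|I|%:R * rho ^+ size w.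
Proof.
move=> mx my; have [bx _] := mixed_run w mx; have [by' _] := mixed_run w my.
apply: le_trans (prodr_dist (fun i => choice01 (be i) bx) (fun i => choice01 (be i) by')) _.
have -> : #|I|%:R * rho ^+ size w = \sum_(i : I) rho ^+ size w.
  by rewrite mulr_natl; symmetry; exact: sumr_const.
apply: ler_sum => i _; rewrite opprD addrACA subrr addr0 -mulrBr normrM.
rewrite ger0_norm ?subr_ge0 ?(ltW l1)//.
have := run_dist w (Tagged A (be i)) mx.1 my.1; apply: le_trans.
by rewrite ler_piMl// lerBlDr lerDl ltW.
Qed.

Let e0 : profile A := [ffun i => a0 i].
Let x0 : Defs.coord A -> R := (pure_state R e0).2.

Let mx0 : mixed x0.
Proof.
split; first exact: pure_in_box.
move=> i; rewrite /x0 /= (bigD1 (e0 i))//= eqxx big1 ?addr0// => a /negbTE ->.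
by [].
Qed.

(** The Feller property, by which [K g] can be evaluated along the approximations of the limiting
    state, just as [g]. *)
Lemma regular_transition (g : S -> R) : regular g -> regular (K g).
Proof.
move=> [bg cg]; apply: regular_sum => be _; apply: regularM; first exact: regular_choice_prob.
split; first by apply: bounded_measurable_comp => //; exact: measurable_update.
move=> al x e epos; have [d d0 dP] := cg be (T be (clamped ((al, x) : S))) e epos.
exists d => // y xy; apply: dP => k.
have /andP[r0 r1] := contraction01.
apply: le_lt_trans (xy k); rewrite (le_trans (next_strat_dist _ _ _ _))//.
rewrite (@le_trans _ _ `|clamp (x k) - clamp (y k)|)//; last exact: clamp_lipschitz.
by rewrite ler_piMl// ltW.
Qed.

Lemma transition_mixed (g : S -> R) al x : mixed x ->
  K g (al, x) = \sum_be p be x * g (be, T be x).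
Proof.
move=> [xb x1]; apply: eq_bigr => be _; rewrite /choice_prob /update.
have -> : clamped ((al, x) : S) = x by apply/funext => k; rewrite /clamped clamp_id.
by [].
Qed.

(** [Y t] is the state produced by the infinite past coded by [t], and [Yn n t] the one produced by
    its last [n] actions from [x0]. Given these actions, the next one is distributed as a draw from
    the current state up to an error of order [rho^n], so the law of [Y] is stationary. *)
Lemma invariant_exists : exists mu : probability S R, Defs.invariant u eps lam mu.
Proof.
have /andP[r0 r1] := contraction01.
have [q [q0 q1 qS qr]] := stationary_words mixed_next
  (fun be x mx => next_prob_ge0 be mx.1) sum_next_prob
  (dl := fun n => #|I|%:R * rho ^+ n) next_prob_run_dist mx0.
pose c n t := code e0 q n t.
pose X n t := run T x0 (c n t).
have mX n t : mixed (X n t) by exact: mixed_run.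
have Xcvg t k : cvgn (fun n => X n t k).
  (* The new letter is older and stands in front: [X n.+1 t] and [X n t] run the same [n] actions
     from two different starting points. *)
  apply: (geometric_increments_cvg contraction01) => n; rewrite /X /c /=.
  set be := locate _ _ _ _.
  by have := run_dist (code e0 q n t) k (mixed_next be mx0).1 mx0.1; rewrite size_code.
pose Xl t k : R := limn (fun n => X n t k).
have bX n (h : (Defs.coord A -> R) -> R) :
    bounded_measurable (fun t : measurableTypeR R => h (X n t)).
  exact: (bounded_measurable_code e0 q0 q1 qS n (fun w => h (run T x0 w))).
have mXl : forall k, measurable_fun [set: measurableTypeR R] (fun t => Xl t k).
  move=> k; apply: (@measurable_fun_cvg _ _ _ _ (fun n t => X n t k)) => [n|t _].
    by case: (bX n (fun x => x k)).
  exact: Xcvg.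
(* The newest action is the last letter, which no longer changes once the code is nonempty. The
   empty code yields the default [e0], whence the shift to [n.+1] below. *)
pose act t : profile A := last e0 (c 1%N t).
have actE n t : last e0 (c n.+1 t) = act t.
  have last_cons (be : profile A) w : (0 < size w)%N -> last e0 (be :: w) = last e0 w.
    by case: w.
  by elim: n => // n IH; rewrite -IH; apply: last_cons; rewrite size_code.
pose Y t : S := (act t, Xl t).
pose Yn n t : S := (last e0 (c n t), X n t).
have mY : measurable_fun [set: measurableTypeR R] Y.
  apply: measurable_to_state => // be.
  have [mb _] := bounded_measurable_code e0 q0 q1 qS 1
    (fun w => (last e0 w == be : nat)%:R : R).
  have := mb measurableT [set 1] (measurable_set1 _); rewrite setTI.
  congr measurable; apply/seteqP; split=> t /=; rewrite /act /c.
    by case: eqP => //= _ /eqP; rewrite eq_sym oner_eq0.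
  by move=> /= ->; rewrite eqxx.
have Y_cvg (g : S -> R) t : regular g -> g (Yn n.+1 t) @[n --> \oo] --> g (Y t).
  move=> [_ cg]; apply/cvgrPdist_lt => e epos.
  have [d d0 dP] := cg (act t) (Xl t) e epos.
  have : \forall n \near \oo, forall k, `|Xl t k - X n.+1 t k| < d.
    apply: filter_forall => k.
    have ck : X n.+1 t k @[n --> \oo] --> Xl t k.
      by rewrite (cvg_shiftS (fun n => X n t k)); exact: Xcvg.
    by have /cvgrPdist_lt/(_ _ d0) := ck.
  by apply: filterS => n /dP; rewrite /Y /Yn actE.
have bYn n (g : S -> R) : bounded_measurable (fun t : measurableTypeR R => g (Yn n t)).
  exact: (bounded_measurable_code e0 q0 q1 qS n (fun w => g (last e0 w, run T x0 w))).
have EYn n (g : S -> R) : \int[unif (R := R)]_t g (Yn n t) =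
    wsum n (fun w => q w * g (last e0 w, run T x0 w)).
  exact: (expect_code e0 q0 q1 qS n (fun w => g (last e0 w, run T x0 w))).
have bY (g : S -> R) : bounded_measurable g ->
    bounded_measurable (fun t : measurableTypeR R => g (Y t)).
  by move=> [mg [M gM]]; split; [exact: (measurableT_comp mg mY) | exists M].
have EY (g : S -> R) : regular g ->
    \int[unif (R := R)]_t g (Yn n.+1 t) @[n --> \oo] --> \int[unif (R := R)]_t g (Y t).
  move=> rg; have [[mg [M gM]] _] := rg.
  refine (@bounded_convergence _ _ R (unif (R := R)) (fun n t => g (Yn n.+1 t))
    (fun t => g (Y t)) M _ _ _ _).
  - by move=> n; case: (bYn n.+1 g).
  - by apply: bY; case: rg.
  - by move=> n t; exact: gM.
  - by move=> t; exact: Y_cvg.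
have [mu [muE intE]] := law_exists (unif (R := R)) mY.
exists mu; apply/invariantP; split.
  rewrite muE (_ : _ @^-1` _ = set0) ?measure0//; apply/seteqP; split=> // t /= nS.
  apply: nS => i; split=> [a|].
    apply: limr_ge; first exact: Xcvg.
    by apply: nearW => n; have [/(_ (Tagged A a))/andP[]] := mX n t.
  have cs : (fun n => \sum_(a : A i) X n t (Tagged A a)) @ \oo -->
      \sum_(a : A i) Xl t (Tagged A a).
    elim: (index_enum _) => [|a r IH].
      by under eq_fun do rewrite big_nil; rewrite big_nil; exact: cvg_cst.
    under eq_fun do rewrite big_cons; rewrite big_cons.
    by apply: cvgD; [exact: (Xcvg t (Tagged A a)) | exact: IH].
  apply: (cvg_unique (@Rhausdorff R) cs).
  rewrite (_ : (fun n => _) = fun=> 1); first exact: cvg_cst.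
  by apply/funext => n; have [_ ->] := mX n t.
apply: stationary_of_regular => g rg.
have rKg := regular_transition rg; have [bg _] := rg; have [bKg _] := rKg.
rewrite !intE//.
have [mg [M gM]] := bg.
have M0 : 0 <= M := le_trans (normr_ge0 _) (gM (e0, x0)).
have c1 : \int[unif (R := R)]_t g (Yn n.+2 t) - \int[unif (R := R)]_t K g (Yn n.+1 t)
    @[n --> \oo] --> \int[unif (R := R)]_t g (Y t) - \int[unif (R := R)]_t K g (Y t).
  apply: cvgB; last exact: EY.
  by have := EY g rg; rewrite -(cvg_shiftS (fun n => \int[unif (R := R)]_t g (Yn n.+1 t))).
have wq n : wsum n q = 1.
  have := expect_code e0 q0 q1 qS n (fun=> 1); rewrite expect_cst => ->.
  by apply: eq_wsum => w _; rewrite mulr1.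
pose C := #|{: profile A}|%:R * (M * #|I|%:R).
have bound n : `|\int[unif (R := R)]_t g (Yn n.+1 t) - \int[unif (R := R)]_t K g (Yn n t)| <=
    C * rho ^+ n.
  (* With the newest letter split off, [qr] compares its conditional probability after [w] with the
     choice probability at [run T x0 w]. *)
  rewrite !EYn wsum_rcons -wsumB (le_trans (wsum_norm _ _))//.
  rewrite -[leRHS]mulr1 -(wq n) -wsumZ; apply: ler_wsum => w wn.
  rewrite transition_mixed; last exact: mixed_run.
  rewrite mulr_sumr -sumrB (le_trans (ler_norm_sum _ _ _))//.
  have -> : C * rho ^+ n * q w = \sum_(be : profile A) (M * #|I|%:R * rho ^+ n * q w).
    transitivity (#|{: profile A}|%:R * (M * #|I|%:R * rho ^+ n * q w)).
      by rewrite /C !mulrA.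
    by rewrite mulr_natl; symmetry; exact: sumr_const.
  apply: ler_sum => be _; rewrite last_rcons /run foldl_rcons -/(run T x0 w) mulrA -mulrBl.
  rewrite normrM mulrC -!mulrA ler_pM//.
  by have := qr w be; rewrite wn -mulrA.
have c2 : \int[unif (R := R)]_t g (Yn n.+2 t) - \int[unif (R := R)]_t K g (Yn n.+1 t)
    @[n --> \oo] --> (0 : R).
  apply/norm_cvg0P.
  apply: (@squeeze_cvgr _ _ _ _ (fun=> 0) (fun n => C * rho ^+ n.+1)).
  - by apply: nearW => n; rewrite normr_ge0 bound.
  - exact: cvg_cst.
  - rewrite -(mulr0 C); apply: cvgM; first exact: cvg_cst.
    rewrite (cvg_shiftS (fun n => rho ^+ n)); apply: cvg_expr.
    by rewrite ger0_norm.
by apply/eqP; rewrite -subr_eq0; apply/eqP; exact: (cvg_unique (@Rhausdorff R) c1 c2).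
Qed.

End Existence.

(** * The limit of small step sizes *)

Section SmallStep.
Context {R : realType} {I : finType} {A : I -> finType} (a0 : forall i, A i).
Variable u : I -> profile A -> R.
Hypothesis coord : coordination_game u.

Lemma utility_bounds : exists m U : R,
  [/\ 0 < m, 0 <= U, forall i al, m <= u i al & forall i al, u i al <= U].
Proof.
have u0 := coord.1.
have le_sum2 (f : I -> profile A -> R) i al : (forall i al, 0 <= f i al) ->
    f i al <= \sum_i \sum_al f i al.
  move=> f0; rewrite (bigD1 i)//= (bigD1 al)//= -addrA lerDl addr_ge0 ?sumr_ge0//.
  by move=> j _; rewrite sumr_ge0.
pose V := \sum_i \sum_al (u i al)^-1 + 1.
have V0 : 0 < V.
  rewrite ltr_wpDl// sumr_ge0// => i _; rewrite sumr_ge0// => al _.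
  by rewrite invr_ge0 ltW.
exists V^-1, (\sum_i \sum_al u i al); split.
- by rewrite invr_gt0.
- by rewrite sumr_ge0// => i _; rewrite sumr_ge0// => al _; rewrite ltW.
- move=> i al; rewrite -[leRHS]invrK lef_pV2 ?posrE ?invr_gt0//.
  apply: ler_wpDr => //.
  by apply: (le_sum2 (fun i al => (u i al)^-1)) => j be; rewrite invr_ge0 ltW.
- by move=> i al; apply: le_sum2 => j be; rewrite ltW.
Qed.

(** There are finitely many ratios [u u' / (u - u')], and the sum of their absolute values dominates
    each of them. *)
Lemma utility_gap : exists2 c : R, 0 < c &
  forall i al be, u i be < u i al -> u i al * u i be <= c * (u i al - u i be).
Proof.
pose f i al be := `|u i al * u i be / (u i al - u i be)|.
exists (\sum_i \sum_al \sum_be f i al be + 1).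
  rewrite ltr_wpDl//; apply: sumr_ge0 => i _; apply: sumr_ge0 => al _.
  by apply: sumr_ge0 => be _; exact: normr_ge0.
move=> i al be lt; have d0 : 0 < u i al - u i be by rewrite subr_gt0.
rewrite -ler_pdivrMr//; apply: ler_wpDr => //; apply: (le_trans (ler_norm _)).
rewrite (bigD1 i)//= (bigD1 al)//= (bigD1 be)//= -!addrA lerDl.
by rewrite !addr_ge0//; repeat (apply: sumr_ge0 => ? _); exact: normr_ge0.
Qed.

(** The constant must not depend on [eps]. Only [k] and the scale of [frac] depend on it, and
    neither enters [potential_bound]. *)
Lemma limit_vector_not_NE : exists C : R,
  forall (eps : R) pi al, 0 < eps -> valid_eps u eps -> limit_vector a0 u eps pi ->
    ~ pure_NE u al -> pi al <= C * eps.
Proof.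
have [m [U [m0 U0 um uU]]] := utility_bounds; have [c c0 cu] := utility_gap.
(* Summing over the players meets the requirement of [tremble_not_NE] for all of them. *)
pose B := 1 + \sum_i #|I|.+1%:R * #|A i|%:R * (m + c) / m.
have mc : 0 < m + c by rewrite addr_gt0.
have t0 i : 0 <= #|I|.+1%:R * #|A i|%:R * (m + c) / m.
  by rewrite divr_ge0 ?mulr_ge0 ?ler0n// ltW.
have B1 : 1 <= B by rewrite lerDl sumr_ge0.
have Bbig i : #|I|.+1%:R * #|A i|%:R * (m + c) <= B * m.
  rewrite -ler_pdivrMr// /B (bigD1 i)//= addrCA lerDl addr_ge0//.
  by apply: sumr_ge0 => j _; exact: t0.
pose M := potential_bound (A := A) B.
have M0 : 0 < M by rewrite exprn_gt0// (lt_le_trans ltr01).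
pose C := #|I|%:R * M * U.
have C0 : 0 <= C by rewrite !mulr_ge0 ?ler0n// ltW.
exists C => eps pi al e0 valid lv nne.
pose k := (Num.truncn (eps * m)^-1).+1.
have kP : 1 <= k%:R * (eps * m).
  by rewrite -ler_pdivrMr ?mulr_gt0// mul1r ltW// truncnS_gt.
have half01 : 0 < (2^-1 : R) < 1 by apply/andP; split; lra.
have [mu0 _] := invariant_exists a0 valid half01.
(* [limit_vector] speaks of families indexed by all reals; outside []0, 1[] the measure [mu0] is
   used. *)
have /choice[mu muP] : forall lam : R, exists mu : probability (learning_space R a0) R,
    0 < lam < 1 -> Defs.invariant u eps lam mu.
  move=> lam; have [l01|] := boolP (0 < lam < 1); last by exists mu0.
  by have [mu ?] := invariant_exists a0 valid l01; exists mu.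
pose F := potential u eps c k B.
have := limit_tremble_le valid M0 (F := F) (potential_le u k e0 c0 B1)
  (regular_potential u k B e0 c0) (potential_subharmonic valid e0 c0 um cu kP B1) lv muP.
have [pi0 [pi1 _]] := lv.
pose n : R := #|I|%:R.
pose Tr be := tremble u eps F (pure_state R be : learning_space R a0).
pose Fp be := F (pure_state R be).2.
rewrite -[leLHS]/(\sum_be pi be * Tr be).
have -> : \sum_be pi be * (fun s : learning_space R a0 => F (clamped s)) (pure_state R be) =
    \sum_be pi be * Fp be.
  by apply: eq_bigr => be _; rewrite /= clamped_pure.
have Ce : 0 <= C * eps by rewrite mulr_ge0// ltW.
(* Equilibria lose at most [C eps]; the other profiles gain at least [1], of which only the gain at
   [al] is kept. Summed over [be] and combined with [limit_tremble_le], the terms in [Fp] cancel and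
   leave [pi al <= C eps]. *)
have step be : n * (pi be * Fp be) - C * eps * pi be + (be == al)%:R * pi be <= pi be * Tr be.
  have [ne|ne] := pselect (pure_NE u be).
    have bal : be == al = false by apply/eqP => e; rewrite e in ne.
    have := ler_wpM2l (pi0 be) (tremble_NE a0 coord valid e0 c0 kP B1 U0 uU ne).
    by rewrite bal mul0r addr0 -/Fp -/(Tr be) -/(Fp be) -/M -/C mulrBr mulrCA [pi be * (C * eps)]mulrC.
  have := ler_wpM2l (pi0 be) (tremble_not_NE a0 coord e0 c0 m0 um kP B1 Bbig ne).
  rewrite -/(Tr be) -/(Fp be) mulrDr mulr1 mulrCA; apply: le_trans.
  rewrite -addrA lerD2l; apply: ler_wnDl; first by rewrite oppr_le0 mulr_ge0.
  by case: (be == al); rewrite ?mul1r ?mul0r.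
have := ler_sum (index_enum (profile A)) (fun be (_ : xpredT be) => step be).
rewrite big_split sumrB /= -!mulr_sumr pi1 mulr1.
have -> : \sum_be (be == al)%:R * pi be = pi al.
  by rewrite (bigD1 al)//= eqxx mul1r big1 ?addr0// => be /negbTE ->; rewrite mul0r.
by move=> h1 h2; have := le_trans h1 h2; rewrite -lerBrDl opprB addrC subrK.
Qed.

End SmallStep.


(** * Vanishing weight of the profiles that are not equilibria *)

Theorem theorem6p1 (R : realType) (I : finType) (A : I -> finType)
  (a0 : forall i, A i) (u : I -> profile A -> R) :
  coordination_game u ->
  forall al : profile A,
    stochastically_stable a0 u al -> pure_NE u al.
Proof.
move=> coord al [Pi [PiP nlim]]; apply: contrapT => nne; apply: nlim.
have [m [U [m0 U0 um uU]]] := utility_bounds coord.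
have [C bound] := limit_vector_not_NE a0 coord.
have U1 : 0 < U + 1 by rewrite ltr_wpDl.
(* Utilities are bounded, so all small step sizes are valid; [U + 1] is a positive bound to divide
   by. *)
have epsP : \forall eps \near (0 : R)^'+, 0 < eps /\ valid_eps u eps.
  near=> eps; have e0 : 0 < eps by near: eps; exact: nbhs_right_gt.
  split=> // i be; rewrite mulr_gt0 ?coord.1//=.
  apply: (@le_lt_trans _ _ (eps * U)); first by rewrite ler_wpM2l// ltW.
  apply: (@lt_trans _ _ (eps * (U + 1))); first by rewrite ltr_pM2l// ltrDl.
  rewrite -ltr_pdivlMr// mul1r; near: eps; apply: nbhs_right_lt.
  by rewrite invr_gt0.
apply: (@squeeze_cvgr _ _ _ _ (fun=> 0) (fun eps => C * eps)).
- apply: filterS epsP => eps [e0 /[dup] valid /PiP lv]; have [pi0 _] := lv.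
  by rewrite pi0 bound.
- exact: cvg_cst.
- rewrite -[X in _ --> X](mulr0 C); apply: cvgM; first exact: cvg_cst.
  exact: cvg_at_right_filter.
Unshelve. all: by end_near. Qed.
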